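(* Let $n,m\ge1$ be integers, let $1<p<q<\infty$, $1<s_k<p'$ for $k=1,\dots,m$, and $\frac1q+\frac m{p'}=\sum_{k=1}^m\frac1{s_k}$. Put $\lambda_k=n/s_k$. There is a finite constant $C$, depending only on $n,m,p,q,s_1,\dots,s_m$, such that for every $H\in L^p(\mathbb R^{nm})$ the function $$F(x)=\int_{\mathbb R^{nm}}\prod_{k=1}^m|x-y_k|^{-\lambda_k}\,H(y_1,\dots,y_m)\,dy_1\cdots dy_m,\qquad x\in\mathbb R^n,$$ satisfies $$\|F\|_{L^q(\mathbb R^n)}\le C\,\|H\|_{L^p(\mathbb R^{nm})}.$$
   Context: Points of $\mathbb R^{nm}$ are written $(y_1,\dots,y_m)$ with $y_k\in\mathbb R^n$. Primes denote dual exponents: $1/p+1/p'=1$. *)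

(* Defs.v *)
From HB Require Import structures.
From mathcomp Require Import all_boot all_order all_algebra.
From mathcomp Require Import all_classical all_reals all_analysis.
Set Implicit Arguments. Unset Strict Implicit. Unset Printing Implicit Defensive.
Import Order.TTheory GRing.Theory Num.Theory.
Import numFieldNormedType.Exports.
Local Open Scope classical_set_scope.
Local Open Scope ring_scope.

Section tuple_measure.
Context d (T : measurableType d) (R : realType).
Variable mu : {sigma_finite_measure set T -> \bar R}.

Definition tcons n (z : T * n.-tuple T) : n.+1.-tuple T :=
  [tuple of z.1 :: z.2].

Lemma measurable_tcons n : measurable_fun [set: T * n.-tuple T] (@tcons n).
Proof. exact: measurable_cons. Qed.

Section step.
Variables (n : nat) (nu : {sigma_finite_measure set (n.-tuple T) -> \bar R}).

Definition tuple_measureS : set (n.+1.-tuple T) -> \bar R :=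
  pushforward (mu \x nu)%E (@tcons n).

Let tuple_measureS0 : tuple_measureS set0 = 0%E.
Proof. by rewrite /tuple_measureS /pushforward preimage_set0 measure0. Qed.

Let tuple_measureS_ge0 A : (0 <= tuple_measureS A)%E.
Proof. exact: (measure_ge0 (mu \x nu)%E). Qed.

Let tuple_measureS_sigma_additive : semi_sigma_additive tuple_measureS.
Proof.
move=> F mF tF mUF; rewrite /tuple_measureS /pushforward preimage_bigcup.
apply: measure_semi_sigma_additive.
- by move=> k; rewrite -[X in measurable X]setTI; exact: measurable_tcons.
- apply/trivIsetP => /= i j _ _ ij; rewrite -preimage_setI.
  by move/trivIsetP : tF => /(_ _ _ _ _ ij) ->//; rewrite preimage_set0.
- rewrite -preimage_bigcup -[X in measurable X]setTI.
  exact: measurable_tcons.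
Qed.

HB.instance Definition _ := isMeasure.Build _ _ _ tuple_measureS
  tuple_measureS0 tuple_measureS_ge0 tuple_measureS_sigma_additive.

Let tuple_measureS_sigma_finite : sigma_finite setT tuple_measureS.
Proof.
have /sigma_finiteP[F [FT ndF Foo]] := sigma_finiteT mu.
have /sigma_finiteP[G [GT ndG Goo]] := sigma_finiteT nu.
pose unc (t : n.+1.-tuple T) := (thead t, [tuple of behead t] : n.-tuple T).
have munc : measurable_fun setT unc.
  apply/measurable_fun_pair => /=; first exact: measurable_tnth.
  exact: measurable_behead.
have tconsK z : unc (tcons z) = z.
  by case: z => x t; congr pair; exact/val_inj.
exists (fun k => unc @^-1` (F k `*` G k)).
  apply/esym; rewrite -subTset => t _.
  have [i _ Fi] : (\bigcup_i F i) (unc t).1 by rewrite -FT.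
  have [j _ Gj] : (\bigcup_i G i) (unc t).2 by rewrite -GT.
  exists (maxn i j) => //; split.
  - by move: Fi; apply/subsetPset/ndF/leq_maxl.
  - by move: Gj; apply/subsetPset/ndG/leq_maxr.
move=> k; have [mF Fk] := Foo k; have [mG Gk] := Goo k; split.
  by rewrite -[X in measurable X]setTI; apply: munc => //; exact: measurableX.
rewrite /tuple_measureS /pushforward.
have -> : @tcons n @^-1` (unc @^-1` (F k `*` G k)) = F k `*` G k.
  by rewrite -comp_preimage (_ : unc \o _ = id) //; exact/funext.
by rewrite product_measure1E// lte_mul_pinfty// ge0_fin_numE.
Qed.

HB.instance Definition _ := Measure_isSigmaFinite.Build _ _ _
  tuple_measureS tuple_measureS_sigma_finite.

End step.

(* The n-fold product measure of mu on T^n. *)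
Fixpoint tuple_measure n : {sigma_finite_measure set (n.-tuple T) -> \bar R} :=
  match n with
  | 0 => \d_([tuple] : 0.-tuple T)
  | k.+1 => tuple_measureS (tuple_measure k)
  end.

Lemma tuple_measure_box n (A : 'I_n -> set T) :
  (forall i, measurable (A i)) ->
  tuple_measure n [set t | forall i, A i (tnth t i)] = (\prod_(i < n) mu (A i))%E.
Proof.
elim: n A => [|n IH] A mA.
  by rewrite big_ord0 /= diracE mem_set// => -[].
rewrite big_ord_recl /= -IH// /tuple_measureS /pushforward.
have mB : measurable [set t : n.-tuple T | forall i, A (lift ord0 i) (tnth t i)].
  rewrite (_ : mkset _ = \bigcap_(i in [set: 'I_n])
      ((fun t : n.-tuple T => tnth t i) @^-1` A (lift ord0 i))).
    apply: fin_bigcap_measurable => // i _.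
    by rewrite -[X in measurable X]setTI; apply: measurable_tnth.
  by apply/seteqP; split => t /= At i; [move=> _|]; exact: At.
rewrite -product_measure1E//; congr product_measure1.
apply/seteqP; split => -[x t] /=.
  move=> At; split; first by have := At ord0; rewrite tnth0.
  by move=> i; have := At (lift ord0 i); rewrite tnthS.
move=> [Ax At] i; case: (unliftP ord0 i) => [j|] ->; last by rewrite tnth0.
by rewrite tnthS.
Qed.

End tuple_measure.

Section multilinear_fractional_integral.
Variable R : realType.

Definition Rn n := n.-tuple (measurableTypeR R).

(* R^(nm), presented as m-tuples (y_1, ..., y_m) of points of R^n. *)
Definition Rnm n m := m.-tuple (Rn n).

Definition lebesgueRn n : {sigma_finite_measure set (Rn n) -> \bar R} :=
  tuple_measure lebesgue_measure n.

Definition lebesgueRnm n m : {sigma_finite_measure set (Rnm n m) -> \bar R} :=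
  tuple_measure (lebesgueRn n) m.

(* Euclidean distance; the norm that the library puts on matrices is the sup
   norm. *)
Definition edist n (x y : Rn n) : R :=
  Num.sqrt (\sum_(i < n) ((tnth x i : R) - (tnth y i : R)) ^+ 2).

(* F(x), as an extended real. For a > 0, 0 `^ (- a) = 0, so the kernel is set
   to 0 instead of +oo where some y_k = x, a null set when n > 0. Where the
   integral does not converge absolutely, the library's integral of the
   measurable integrand is +oo or -oo (the latter also for oo - oo), never a
   finite default value. *)
Definition multi_frac_int n m (lambda : 'I_m -> R) (H : Rnm n m -> R)
    (x : Rn n) : \bar R :=
  (\int[lebesgueRnm n m]_y
     ((\prod_(k < m) edist x (tnth y k) `^ (- lambda k)) * H y)%:E)%E.

End multilinear_fractional_integral.

(* Main.v *)
Require Import Defs.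
From mathcomp Require Import all_boot all_order all_algebra.
From mathcomp Require Import all_classical all_reals all_analysis.
From mathcomp Require Import measurable_realfun ring lra.
Set Implicit Arguments.
Unset Strict Implicit.
Unset Printing Implicit Defensive.
Import Order.TTheory GRing.Theory Num.Theory.
Import numFieldNormedType.Exports.
Local Open Scope classical_set_scope.
Local Open Scope ring_scope.

(* Write a_k = 1/s_k - 1/p' > 0, so that the a_k sum to 1/q. Split the integral
   according to which y_k is nearest to x. If it is y_k, then Hoelder's inequality
   in each of the other variables, over |x - y_j| >= |x - y_k|, bounds that part by
   a constant times the integral of |x - z|^(-n (1/p' + 1/q)) h_k(z), where h_k(z)
   is the L^p norm of H on the slice y_k = z. As the L^p norm of h_k is that of H,
   this reduces the theorem to m = 1, the Hardy-Littlewood-Sobolev inequality.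

   The latter is proved pointwise (see hls_pointwise), without maximal functions
   or interpolation. Only the bound of the measure of balls by c r for
   rho(x, y) = |x - y|^n matters, so everything is done for a symmetric function
   rho on a sigma-finite measure space with this property. *)

(** * Powers of a function with small sublevel sets, integrated by dyadic shells *)

Lemma dyadic_scale (R : realType) (t : R) : 1 <= t ->
  exists i : nat, 2 ^+ i <= t < 2 ^+ i.+1.
Proof.
move=> t1; have [n tn] : exists n, t < 2 ^+ n.+1.
  exists (Num.trunc t); apply: (lt_trans (truncnS_gt _)).
  by rewrite -natrX ltr_nat; exact: ltn_expl.
elim: n tn => [|n IH] tn; first by exists 0%N; rewrite expr0 t1.
by have [/IH//|tn'] := ltP t (2 ^+ n.+1); exists n.+1; rewrite tn' tn.
Qed.

Lemma two_powR_lt1 (R : realType) (x : R) : x < 0 -> (2 : R) `^ x < 1.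
Proof.
move=> x0; rewrite -[ltRHS](powRr0 2) /powR !pnatr_eq0/=.
by rewrite ltr_expR ltr_pM2r ?ln_gt0//; lra.
Qed.

Section shells.
Context d (T : measurableType d) (R : realType).
Variables (mu : {measure set T -> \bar R}) (u : T -> R) (c : R).
Hypotheses (u_meas : measurable_fun setT u) (c_ge0 : 0 <= c).
Hypothesis ballu : forall r, 0 < r -> (mu [set t | (u t < r)%R] <= (c * r)%:E)%E.

Lemma shell_integral_le (f : T -> R) (v w : nat -> R) (A z : R) :
  measurable_fun setT f -> (forall t, 0 <= f t) ->
  (forall i, 0 <= v i) -> (forall i, 0 < w i) ->
  0 <= A -> 0 < z < 1 -> (forall i, v i * w i <= A * z ^+ i) ->
  (forall t, 0 < f t -> exists2 i, u t < w i & f t <= v i) ->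
  (\int[mu]_t (f t)%:E <= (c * (A * (1 - z)^-1))%:E)%E.
Proof.
move=> mf f0 v0 w0 A0 /andP[z0 z1] vw fvw.
pose g i t : \bar R := ((v i)%:E * (\1_[set t | (u t < w i)%R] t)%:E)%E.
have mB i : measurable [set t | u t < w i].
  rewrite -[X in measurable X]setTI.
  exact: (measurable_fun_ltr u_meas (measurable_cst (w i))).
have g0 i t : (0 <= g i t)%E by rewrite mule_ge0 ?lee_fin.
have mg i : measurable_fun setT (g i).
  apply: measurable_funeM; apply/measurable_EFinP; exact: measurable_indic.
apply: (@le_trans _ _ (\int[mu]_t \sum_(i <oo) g i t)%E).
  apply: ge0_le_integral => //.
  - by move=> t _; rewrite lee_fin.
  - exact/measurable_EFinP.
  - by apply: ge0_emeasurable_sum => // k t _ _; exact: g0.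
  move=> t _; have := f0 t; rewrite le_eqVlt => /predU1P[<-|/fvw[i uw fv]].
    exact: nneseries_ge0.
  apply: le_trans (nneseries_lim_ge i.+1 _) => [|//].
  rewrite big_nat_recr//= -[leLHS]add0e leeD//.
    by apply: sume_ge0 => k _; exact: g0.
  by rewrite /g indicE mem_set//= mule1 lee_fin.
rewrite integral_nneseries//; apply: lime_le.
  by apply: is_cvg_nneseries => n _ _; exact: integral_ge0.
apply: nearW => n.
apply: (@le_trans _ _ (\sum_(0 <= i < n) (c * (A * z ^+ i))%:E)%E).
  apply: lee_sum => i _; rewrite ge0_integralZl//; last by rewrite lee_fin.
    rewrite integral_indic// setIT.
    apply: (@le_trans _ _ ((v i)%:E * (c * w i)%:E)%E).
      by rewrite lee_wpmul2l ?lee_fin//; exact: ballu.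
    by rewrite -EFinM lee_fin mulrCA ler_wpM2l.
  by apply/measurable_EFinP; exact: measurable_indic.
rewrite sumEFin lee_fin -mulr_sumr ler_wpM2l//.
have := geometric_le_lim n A0 z0; rewrite gtr0_norm// => /(_ z1).
by rewrite /series.
Qed.

Hypothesis u_ge0 : forall t, 0 <= u t.

(** The shells are r 2^-(i+1) < u <= r 2^-i. Value times measure decays like 2^(i (a - 1)), which is
    summable because [a < 1]. *)
Lemma inner_integral_le (a r : R) : 0 < a < 1 -> 0 < r ->
  (\int[mu]_t (if u t < r then u t `^ (- a) else 0)%R%:E <=
   (c * (4 * r `^ (1 - a) * (1 - 2 `^ (a - 1))^-1))%:E)%E.
Proof.
move=> /andP[a0 a1] r0.
pose z : R := 2 `^ (a - 1).
have zE i : (r * 2 ^- i) `^ (1 - a) = r `^ (1 - a) * z ^+ i.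
  rewrite powRM ?ltW// ?exprn_gt0//; congr (_ * _).
  by rewrite -powR_invn// -powRrM mulNr -mulrN opprB mulrC powRrM powR_mulrn ?powR_ge0.
have z01 : 0 < z < 1.
  by rewrite powR_gt0//=; apply: two_powR_lt1; lra.
have half_gt0 i : 0 < r * 2 ^- i by rewrite mulr_gt0// invr_gt0 exprn_gt0.
(* The value is bounded at the inner radius of the shell. The factor 2 in the outer radius turns u
   <= r 2^-i into the strict inequality that [ballu] requires. *)
apply: (@shell_integral_le _
  (fun i => (r * 2 ^- i.+1) `^ (- a)) (fun i => 2 * (r * 2 ^- i))) => //.
- apply: measurable_fun_ifT => //.
    exact: (measurable_fun_ltr u_meas (measurable_cst r)).
  exact: (measurableT_comp (measurable_powR (- a)) u_meas).
- by move=> t; case: ifP => // _; exact: powR_ge0.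
- by move=> i; exact: powR_ge0.
- by move=> i; rewrite mulr_gt0.
- by rewrite mulr_ge0 ?powR_ge0.
- move=> i; have -> : 2 * (r * 2 ^- i) = 4 * (r * 2 ^- i.+1).
    by rewrite exprS; field.
  rewrite mulrCA -[X in _ * (_ * X)](powRr1 (ltW (half_gt0 _))).
  rewrite -powRD; last by apply/implyP => _; rewrite gt_eqF.
  rewrite addrC zE -mulrA ler_pM2l// ler_wpM2l ?powR_ge0// exprS.
  by rewrite ger_pMl ?exprn_gt0//; case/andP: z01 => // _ /ltW.
- move=> t; case: ifPn => [ur|]; last by rewrite ltxx.
  (* Points with [u t = 0] lie in no shell, but there the integrand is 0, as 0^(-a) = 0 by
     convention. *)
  have [->|ut0 _] := eqVneq (u t) 0; first by rewrite powR0 ?ltxx// oppr_eq0 gt_eqF.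
  have {}ut0 : 0 < u t by rewrite lt_neqAle eq_sym ut0 u_ge0.
  have [|i /andP[ri ir]] := @dyadic_scale _ (r / u t).
    by rewrite ler_pdivlMr// mul1r ltW.
  exists i.
    rewrite (@le_lt_trans _ _ (r * 2 ^- i))//.
      by rewrite ler_pdivlMr ?exprn_gt0// mulrC -ler_pdivlMr.
    by rewrite ltr_pMl// ltr1n.
  rewrite !powRN lef_pV2 ?posrE ?powR_gt0//.
  apply: ge0_ler_powR; rewrite ?nnegrE ?ltW//.
  by rewrite ltr_pdivrMr ?exprn_gt0// mulrC -ltr_pdivrMr.
Qed.

(** Here the shells r 2^i <= u < r 2^(i+1) grow, and the ratio 2^(1 - a) is below 1 because
    [1 < a]. *)
Lemma outer_integral_le (a r : R) : 1 < a -> 0 < r ->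
  (\int[mu]_t (if r <= u t then u t `^ (- a) else 0)%R%:E <=
   (c * (2 * r `^ (1 - a) * (1 - 2 `^ (1 - a))^-1))%:E)%E.
Proof.
move=> a1 r0.
pose z : R := 2 `^ (1 - a).
have zE i : (r * 2 ^+ i) `^ (1 - a) = r `^ (1 - a) * z ^+ i.
  rewrite powRM ?ltW// ?exprn_gt0//; congr (_ * _).
  by rewrite -powR_mulrn// -powRrM mulrC powRrM powR_mulrn ?powR_ge0.
have z01 : 0 < z < 1.
  by rewrite powR_gt0//=; apply: two_powR_lt1; lra.
have dbl_gt0 i : 0 < r * 2 ^+ i by rewrite mulr_gt0// exprn_gt0.
apply: (@shell_integral_le _
  (fun i => (r * 2 ^+ i) `^ (- a)) (fun i => 2 * (r * 2 ^+ i))) => //.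
- apply: measurable_fun_ifT => //.
    exact: (measurable_fun_ler (measurable_cst r) u_meas).
  exact: (measurableT_comp (measurable_powR (- a)) u_meas).
- by move=> t; case: ifP => // _; exact: powR_ge0.
- by move=> i; exact: powR_ge0.
- by move=> i; rewrite mulr_gt0.
- by rewrite mulr_ge0 ?powR_ge0.
- move=> i; rewrite mulrCA -[X in _ * (_ * X)](powRr1 (ltW (dbl_gt0 _))).
  rewrite -powRD; last by apply/implyP => _; rewrite gt_eqF.
  by rewrite addrC zE -mulrA.
- move=> t; case: ifPn => [ru _|]; last by rewrite ltxx.
  have [|i /andP[ri ir]] := @dyadic_scale _ (u t / r).
    by rewrite ler_pdivlMr// mul1r.
  exists i.
    by rewrite mulrCA -exprS mulrC -ltr_pdivrMr.
  have u0 : 0 < u t by exact: lt_le_trans ru.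
  rewrite !powRN lef_pV2 ?posrE ?powR_gt0//.
  apply: ge0_ler_powR; rewrite ?nnegrE; [lra|exact: ltW|exact: ltW|].
  by rewrite mulrC -ler_pdivlMr.
Qed.

End shells.

(** * Integrals and powers of nonnegative extended-real functions; Hoelder's inequality *)

Lemma ge0_le_integralT d (T : measurableType d) (R : realType)
    (mu : {measure set T -> \bar R}) (f g : T -> \bar R) :
  (forall t, 0 <= f t)%E -> measurable_fun setT f -> measurable_fun setT g ->
  (forall t, f t <= g t)%E -> (\int[mu]_t f t <= \int[mu]_t g t)%E.
Proof. by move=> f0 mf mg fg; exact: ge0_le_integral. Qed.

Lemma le_poweR (R : realType) (r : R) (x y : \bar R) :
  0 <= r -> (0 <= x)%E -> (x <= y)%E -> (x `^ r <= y `^ r)%E.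
Proof.
move=> r0 x0 xy; apply: gt0_ler_poweR => //.
- by rewrite in_itv/= x0 leey.
- by rewrite in_itv/= (le_trans x0 xy) leey.
Qed.

Lemma measurable_fun_poweR d (T : measurableType d) (R : realType)
    (f : T -> \bar R) (p : R) :
  measurable_fun setT f -> measurable_fun setT (fun t => f t `^ p)%E.
Proof. exact: (measurableT_comp (measurable_poweR p)). Qed.

Lemma measurable_fun_powR d (T : measurableType d) (R : realType)
    (f : T -> R) (p : R) :
  measurable_fun setT f -> measurable_fun setT (fun t => f t `^ p).
Proof. exact: (measurableT_comp (measurable_powR p)). Qed.

Lemma ae_fin_of_integral_lty d (T : measurableType d) (R : realType)
    (mu : {measure set T -> \bar R}) (g : T -> \bar R) (p : R) :
  measurable_fun setT g -> (forall t, 0 <= g t)%E -> 0 < p ->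
  (\int[mu]_t g t `^ p < +oo)%E -> {ae mu, forall t, g t \is a fin_num}.
Proof.
move=> mg g0 p0 goo.
have : mu.-integrable setT (fun t => g t `^ p)%E.
  apply/integrableP; split; first exact: measurable_fun_poweR.
  by under eq_integral do rewrite gee0_abs ?poweR_ge0//.
move=> /(integrable_ae measurableT); apply: filterS => t /(_ I).
have := g0 t; case: (g t) => //=.
by rewrite gt_eqF.
Qed.

(** [g] is extended-real because it will be a slice norm, which may be infinite. If its L^p norm is
    infinite, the right side is +oo since [0 < A]. Otherwise [g] is finite almost everywhere and
    Hoelder's inequality applies to its finite part. *)
Lemma ge0_hoelder d (T : measurableType d) (R : realType)
    (mu : {measure set T -> \bar R}) (f : T -> R) (g : T -> \bar R)
    (p p' A : R) :
  measurable_fun setT f -> (forall t, 0 <= f t) ->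
  measurable_fun setT g -> (forall t, 0 <= g t)%E ->
  0 < p -> 0 < p' -> p^-1 + p'^-1 = 1 -> 0 < A ->
  (\int[mu]_t (f t `^ p')%:E <= (A `^ p')%:E)%E ->
  (\int[mu]_t ((f t)%:E * g t) <=
    A%:E * (\int[mu]_t g t `^ p) `^ p^-1)%E.
Proof.
move=> mf f0 mg g0 p0 p'0 pp' A0 fA.
have [goo|] := eqVneq (\int[mu]_t g t `^ p)%E +oo%E.
  by rewrite goo poweRyr ?gt_eqF ?invr_gt0// gt0_muley ?leey.
rewrite -ltey => goo.
have gE := ae_fin_of_integral_lty mg g0 p0 goo.
pose h t := fine (g t).
have mh : measurable_fun setT h by exact: measurableT_comp.
have h0 t : 0 <= h t by exact: fine_ge0.
have -> : (\int[mu]_t ((f t)%:E * g t) = \int[mu]_t (f t * h t)%:E)%E.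
  apply: ge0_ae_eq_integral => //.
  - by apply: emeasurable_funM => //; exact/measurable_EFinP.
  - by apply/measurable_EFinP; exact: measurable_funM.
  - by move=> t _; rewrite mule_ge0// lee_fin.
  - by move=> t _; rewrite lee_fin mulr_ge0.
  - by apply: filterS gE => t gt _; rewrite EFinM fineK.
have := @hoelder _ _ _ mu f h p' p mf mh p'0 p0.
rewrite addrC => /(_ pp'); rewrite Lnorm1.
under eq_integral do rewrite /= ger0_norm ?mulr_ge0//.
move/le_trans; apply; rewrite unlock; apply: lee_pmul; try exact: poweR_ge0.
  rewrite -[leRHS](_ : ((A `^ p')%:E `^ p'^-1)%E = _); last first.
    by rewrite poweR_EFin -powRrM mulfV ?gt_eqF// powRr1// ltW.
  apply: le_poweR; first by rewrite invr_ge0 ltW.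
    by apply: integral_ge0 => t _; exact: poweR_ge0.
  by under eq_integral do rewrite /= ger0_norm//.
apply: le_poweR; first by rewrite invr_ge0 ltW.
  by apply: integral_ge0 => t _; exact: poweR_ge0.
apply: ge0_le_integralT.
- by move=> t; exact: poweR_ge0.
- by apply: measurable_fun_poweR; apply/measurable_EFinP; exact: measurableT_comp.
- exact: measurable_fun_poweR.
- move=> t; rewrite /= ger0_norm// -poweR_EFin.
  apply: le_poweR; [exact: ltW|by rewrite lee_fin|].
  by rewrite /h; have := g0 t; case: (g t) => //= ?; rewrite ?leey.
Qed.

(** * Tonelli's theorem for splitting off the first entry of a tuple, in both orders *)

Section tuple_integral.
Context d (X : measurableType d) (R : realType).
Variable mu : {sigma_finite_measure set X -> \bar R}.
Variables (n : nat) (f : n.+1.-tuple X -> \bar R).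
Hypotheses (mf : measurable_fun setT f) (f_ge0 : forall t, (0 <= f t)%E).

Let mf_tcons : measurable_fun setT (f \o @tcons _ X n).
Proof. exact: measurableT_comp mf (@measurable_tcons _ X n). Qed.

Let integral_tuple_measureS : (\int[tuple_measure mu n.+1]_t f t =
  \int[mu \x tuple_measure mu n]_z (f \o @tcons _ X n) z)%E.
Proof.
have := @ge0_integral_pushforward _ _ _ _ R _ (@measurable_tcons _ X n)
  (mu \x tuple_measure mu n)%E setT f measurableT mf (fun t _ => f_ge0 t).
by rewrite preimage_setT.
Qed.

Lemma integral_tcons1 : (\int[tuple_measure mu n.+1]_t f t =
  \int[mu]_y \int[tuple_measure mu n]_t f (tcons (y, t)))%E.
Proof.
by rewrite integral_tuple_measureS fubini_tonelli1// => z; exact: f_ge0.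
Qed.

Lemma integral_tcons2 : (\int[tuple_measure mu n.+1]_t f t =
  \int[tuple_measure mu n]_t \int[mu]_y f (tcons (y, t)))%E.
Proof.
by rewrite integral_tuple_measureS fubini_tonelli2// => z; exact: f_ge0.
Qed.

Lemma measurable_integral_tcons1 :
  measurable_fun setT (fun y => \int[tuple_measure mu n]_t f (tcons (y, t)))%E.
Proof.
exact: (measurable_fun_fubini_tonelli_F _ mf_tcons (fun z => f_ge0 _)).
Qed.

Lemma measurable_integral_tcons2 :
  measurable_fun setT (fun t => \int[mu]_y f (tcons (y, t)))%E.
Proof.
exact: (measurable_fun_fubini_tonelli_G _ mf_tcons (fun z => f_ge0 _)).
Qed.

Lemma measurable_tconsr y : measurable_fun setT (fun t => f (tcons (y, t))).
Proof. exact: (measurableT_comp mf_tcons (pair1_measurable y)). Qed.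

Lemma measurable_tconsl t : measurable_fun setT (fun y => f (tcons (y, t))).
Proof. exact: (measurableT_comp mf_tcons (pair2_measurable t)). Qed.

End tuple_integral.

Lemma tnth_tcons0 d (X : measurableType d) n (y : X) (t : n.-tuple X) :
  tnth (tcons (y, t)) ord0 = y.
Proof. by rewrite /tcons tnth0. Qed.

Lemma tnth_tconsS d (X : measurableType d) n (y : X) (t : n.-tuple X) (i : 'I_n) :
  tnth (tcons (y, t)) (lift ord0 i) = tnth t i.
Proof. by rewrite /tcons tnthS. Qed.

(** A fractional integral [F] may be infinite at a point, whereas the cutting argument needs a real
    level. Testing all real [t] below [F] suffices: if [F] is +oo, arbitrarily large [t] force [G]
    to be +oo. *)
Lemma poweR_le_of_real (R : realType) (F G : \bar R) (q : R) : 0 < q ->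
  (0 <= F)%E -> (0 <= G)%E ->
  (forall t, 0 < t -> (t%:E <= F)%E -> ((t `^ q)%:E <= G)%E) -> (F `^ q <= G)%E.
Proof.
move=> q0 + G0; case: F => [t||]//.
  rewrite lee_fin poweR_EFin le_eqVlt => /predU1P[<- _|t0 FG]; last exact: FG.
  by rewrite powR0 ?gt_eqF.
move=> _ FG; rewrite poweRyr ?gt_eqF// leye_eq; apply/eqP/eqyP => s s0.
have := FG (s `^ q^-1) (powR_gt0 _ s0) (leey _).
by rewrite -powRrM mulVf ?gt_eqF// powRr1// ltW.
Qed.

(** The sum is at most [m] times its largest term, and the q-th power of that term occurs on the
    right. *)
Lemma poweR_sum_le (R : realType) m (u : 'I_m -> \bar R) (q : R) : 0 < q ->
  (forall k, 0 <= u k)%E ->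
  ((\sum_k u k) `^ q <= (m%:R `^ q)%:E * \sum_k u k `^ q)%E.
Proof.
move=> q0 u0; case: m u u0 => [|m] u u0.
  by rewrite !big_ord0 mule0 poweR0r// gt_eqF.
pose k0 := [arg max_(k > ord0) u k]%O.
have uk0 k : (u k <= u k0)%E.
  by rewrite /k0; case: Order.TotalTheory.arg_maxP => // i _; exact.
apply: (@le_trans _ _ ((m.+1%:R%:E * u k0) `^ q)%E).
  apply: le_poweR; [exact: ltW|exact: sume_ge0|].
  apply: (@le_trans _ _ (\sum_(k < m.+1) u k0)%E); first exact: lee_sum.
  by rewrite sumr_const card_ord mule_natl.
rewrite poweRM// poweR_EFin; apply: lee_wpmul2l; first by rewrite lee_fin powR_ge0.
rewrite (bigD1 k0)//= leeDl// sume_ge0// => k _; exact: poweR_ge0.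
Qed.

(** * Integrating out all variables but the nearest one by Hoelder's inequality *)

Section ball_growth.
Context d (X : measurableType d) (R : realType).
Variables (mu : {sigma_finite_measure set X -> \bar R}) (rho : X -> X -> R).
Variables c p p' q : R.
Hypothesis mrho : measurable_fun setT (fun z : X * X => rho z.1 z.2).
Hypothesis rho_ge0 : forall x y, 0 <= rho x y.
Hypothesis rhoC : forall x y, rho x y = rho y x.
Hypothesis c_gt0 : 0 < c.
Hypothesis ball_rho : forall x r, 0 < r ->
  (mu [set y | (rho x y < r)%R] <= (c * r)%:E)%E.
Hypotheses (p_gt1 : 1 < p) (p'_gt0 : 0 < p') (pp' : p^-1 + p'^-1 = 1).
Hypothesis p_lt_q : p < q.

Let p_gt0 : 0 < p. Proof. exact: lt_trans p_gt1. Qed.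
Let q_gt0 : 0 < q. Proof. exact: lt_trans p_lt_q. Qed.

Lemma measurable_rhor x : measurable_fun setT (rho x).
Proof. exact: (measurableT_comp mrho (pair1_measurable x)). Qed.

Definition ker_out (al r : R) x y := if r <= rho x y then rho x y `^ (- al) else 0.

Lemma ker_out_ge0 al r x y : 0 <= ker_out al r x y.
Proof. by rewrite /ker_out; case: ifP => // _; exact: powR_ge0. Qed.

Lemma measurable_ker_out al r x : measurable_fun setT (ker_out al r x).
Proof.
have mr := measurable_rhor x.
apply: measurable_fun_ifT => //; last exact: measurable_fun_powR.
exact: (measurable_fun_ler (measurable_cst r) mr).
Qed.

(** By Hoelder it is enough to bound the L^p' norm of the truncated kernel. As [1 < al * p'],
    [outer_integral_le] bounds it by a constant times the p'-th root of r^(1 - al p'), that is, by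
    r^(-(al - 1/p')). *)
Lemma ker_out_hoelder (al : R) : p'^-1 < al ->
  exists2 C, 0 < C & forall x r (g : X -> \bar R), 0 < r ->
    measurable_fun setT g -> (forall t, 0 <= g t)%E ->
    (\int[mu]_y ((ker_out al r x y)%:E * g y) <=
      (C * r `^ (- (al - p'^-1)))%:E * (\int[mu]_y g y `^ p) `^ p^-1)%E.
Proof.
move=> pal.
have p'al : 1 < al * p' by rewrite -ltr_pdivrMr// div1r.
pose K : R := (1 - 2 `^ (1 - al * p'))^-1.
have K0 : 0 < K.
  by rewrite invr_gt0 subr_gt0; apply: two_powR_lt1; lra.
have cK0 : 0 < c * (2 * K) by rewrite !mulr_gt0.
exists ((c * (2 * K)) `^ p'^-1); first exact: powR_gt0.
move=> x r g r0 mg g0; apply: (@ge0_hoelder _ _ _ _ _ _ _ p') => //.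
- exact: measurable_ker_out.
- by move=> y; exact: ker_out_ge0.
- by rewrite mulr_gt0// powR_gt0.
have -> : (((c * (2 * K)) `^ p'^-1 * r `^ (- (al - p'^-1))) `^ p') =
    c * (2 * r `^ (1 - al * p') * K).
  rewrite powRM ?powR_ge0// -!powRrM mulVf ?gt_eqF// powRr1 ?ltW//.
  rewrite mulNr mulrBl mulVf ?gt_eqF// opprB; ring.
apply: le_trans (outer_integral_le (measurable_rhor x) (ltW c_gt0) (ball_rho x) p'al r0).
rewrite le_eqVlt; apply/orP; left; apply/eqP/eq_integral => y _.
rewrite /ker_out; case: ifPn => _; last by rewrite powR0 ?gt_eqF.
by rewrite -powRrM mulNr.
Qed.

Let poweRK (u : \bar R) : (0 <= u)%E -> ((u `^ p^-1) `^ p)%E = u.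
Proof. by move=> u0; rewrite -poweRrM mulVf ?gt_eqF// poweRe1. Qed.

Let poweRVK (u : \bar R) : (0 <= u)%E -> ((u `^ p) `^ p^-1)%E = u.
Proof. by move=> u0; rewrite -poweRrM mulfV ?gt_eqF// poweRe1. Qed.

(** Induction on [m]. For a fixed first entry [y], the other entries are integrated out at the cost
    of the slice norm [N y]; then [ker_out_hoelder] applies to [N], whose L^p norm is that of [g] by
    Tonelli. The exponents of [r] add up. *)
Lemma ker_out_prod_hoelder m (al : 'I_m -> R) : (forall j, p'^-1 < al j) ->
  exists2 C, 0 < C & forall x r (g : m.-tuple X -> \bar R), 0 < r ->
    measurable_fun setT g -> (forall t, 0 <= g t)%E ->
    (\int[tuple_measure mu m]_t
        ((\prod_j ker_out (al j) r x (tnth t j))%:E * g t) <=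
      (C * r `^ (- \sum_j (al j - p'^-1)))%:E *
      (\int[tuple_measure mu m]_t g t `^ p) `^ p^-1)%E.
Proof.
elim: m al => [|m IH] al alp.
  exists 1 => // x r g r0 mg g0.
  under eq_integral do rewrite big_ord0 mul1e.
  rewrite big_ord0 oppr0 powRr0 mulr1 mul1e /=.
  rewrite !integral_dirac//=; last exact: measurable_fun_poweR.
  by rewrite !diracT !mul1e poweRVK.
have [C C0 HC] := IH (fun j => al (lift ord0 j)) (fun j => alp _).
have [D D0 HD] := ker_out_hoelder (alp ord0).
exists (C * D); first exact: mulr_gt0.
move=> x r g r0 mg g0.
have mtail n a (j : 'I_n) :
    measurable_fun setT (fun t : n.-tuple X => ker_out a r x (tnth t j)).
  by apply: (measurableT_comp (measurable_ker_out a r x)); exact: measurable_tnth.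
have mprod n (a : 'I_n -> R) : measurable_fun setT
    (fun t : n.-tuple X => \prod_j ker_out (a j) r x (tnth t j)).
  by apply: measurable_prod => j _; exact: mtail.
rewrite integral_tcons1; last 2 first.
- by apply: emeasurable_funM => //; apply/measurable_EFinP; exact: mprod.
- move=> t; rewrite mule_ge0// lee_fin prodr_ge0// => j _; exact: ker_out_ge0.
have mgp : measurable_fun setT (fun t => g t `^ p)%E by exact: measurable_fun_poweR.
have gp0 t : (0 <= g t `^ p)%E by exact: poweR_ge0.
pose N y := ((\int[tuple_measure mu m]_t g (tcons (y, t)) `^ p) `^ p^-1)%E.
have mN : measurable_fun setT N.
  by apply: measurable_fun_poweR; exact: (measurable_integral_tcons1 mu mgp gp0).
have N0 y : (0 <= N y)%E by exact: poweR_ge0.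
have NE : (\int[mu]_y N y `^ p = \int[tuple_measure mu m.+1]_t g t `^ p)%E.
  rewrite (integral_tcons1 mu mgp gp0); apply: eq_integral => y _.
  by rewrite /N poweRK//; apply: integral_ge0 => t _; exact: poweR_ge0.
have S0 : \sum_(j < m.+1) (al j - p'^-1) =
    (al ord0 - p'^-1) + \sum_(j < m) (al (lift ord0 j) - p'^-1).
  by rewrite big_ord_recl.
have rpow : r `^ (- \sum_(j < m.+1) (al j - p'^-1)) = r `^ (- (al ord0 - p'^-1)) *
    r `^ (- \sum_(j < m) (al (lift ord0 j) - p'^-1)).
  by rewrite S0 opprD powRD// (gt_eqF r0) implybT.
pose E := C * r `^ (- \sum_(j < m) (al (lift ord0 j) - p'^-1)).
have E0 : 0 <= E by rewrite mulr_ge0 ?powR_ge0// ltW.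
apply: (@le_trans _ _ (\int[mu]_y (E%:E * ((ker_out (al ord0) r x y)%:E * N y)))%E).
  apply: ge0_le_integralT.
  - move=> y; apply: integral_ge0 => t _; rewrite mule_ge0// lee_fin.
    by rewrite prodr_ge0// => j _; exact: ker_out_ge0.
  - apply: (@measurable_integral_tcons1 _ _ _ _ _ (fun t =>
      (\prod_j ker_out (al j) r x (tnth t j))%:E * g t)%E).
      by apply: emeasurable_funM => //; apply/measurable_EFinP; exact: mprod.
    move=> t; rewrite mule_ge0// lee_fin prodr_ge0// => j _; exact: ker_out_ge0.
  - apply: measurable_funeM; apply: emeasurable_funM => //.
    by apply/measurable_EFinP; exact: measurable_ker_out.
  - move=> y.
    under eq_integral do rewrite big_ord_recl tnth_tcons0 EFinM -muleA.
    rewrite ge0_integralZl//; last 3 first.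
    + apply: emeasurable_funM; last exact: measurable_tconsr.
      apply/measurable_EFinP; under eq_fun do under eq_bigr do rewrite tnth_tconsS.
      exact: mprod.
    + by move=> t _; rewrite mule_ge0// lee_fin prodr_ge0// => j _; exact: ker_out_ge0.
    + by rewrite lee_fin ker_out_ge0.
    rewrite muleCA lee_wpmul2l ?lee_fin ?ker_out_ge0//.
    under eq_integral do under eq_bigr do rewrite tnth_tconsS.
    by apply: HC => //; exact: measurable_tconsr.
rewrite ge0_integralZl//; last 2 first.
- by apply: emeasurable_funM => //; apply/measurable_EFinP; exact: measurable_ker_out.
- by move=> y _; rewrite mule_ge0// lee_fin ker_out_ge0.
apply: le_trans (lee_wpmul2l _ (HD x r N r0 mN N0)) _; first by rewrite lee_fin.
by rewrite NE muleA -EFinM rpow /E mulrACA mulrA [X in (X%:E * _)%E](_ : _ = C * D *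
  (r `^ (- (al ord0 - p'^-1)) * r `^ (- \sum_(j < m) (al (lift ord0 j) - p'^-1))))//; ring.
Qed.

(* The product kernel on the region where y_k is nearest to x. The extra factor
   rho x y_k ^ (- be) collects the powers of rho x y_k that appear when the other
   variables are integrated out one by one. *)
Definition nearest m (k : 'I_m) (al : 'I_m -> R) (be : R) x (t : m.-tuple X) :=
  (\prod_j ker_out (al j) (rho x (tnth t k)) x (tnth t j)) *
  rho x (tnth t k) `^ (- be).

Lemma nearest_ge0 m (k : 'I_m) al be x t : 0 <= nearest k al be x t.
Proof. by rewrite mulr_ge0 ?powR_ge0// prodr_ge0// => j _; exact: ker_out_ge0. Qed.

Lemma measurable_nearest m (k : 'I_m) al be x :
  measurable_fun setT (nearest k al be x).
Proof.
have mt j : measurable_fun setT (fun t : m.-tuple X => rho x (tnth t j)).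
  by apply: (measurableT_comp (measurable_rhor x)); exact: measurable_tnth.
apply: measurable_funM; last exact: measurable_fun_powR.
apply: measurable_prod => j _; apply: measurable_fun_ifT => //.
- exact: measurable_fun_ler.
- exact: measurable_fun_powR.
Qed.

Lemma ker_out_self al x y : ker_out al (rho x y) x y = rho x y `^ (- al).
Proof. by rewrite /ker_out lexx. Qed.

Lemma nearest0 m (k : 'I_m) al be x t : al k != 0 -> rho x (tnth t k) = 0 ->
  nearest k al be x t = 0.
Proof.
move=> ak r0; rewrite /nearest (bigD1 k)//= ker_out_self r0.
by rewrite powR0 ?oppr_eq0// !mul0r.
Qed.

(** [h] is the slice norm of [H] in the k-th variable; it is chosen before [x], so that one function
    serves all [x]. The induction on [m] strips the variables in front of [k], each of which adds
    [al j - p'^-1] to [be]. *)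
Lemma nearest_le_hls m (k : 'I_m) (al : 'I_m -> R) (be : R) :
  (forall j, p'^-1 < al j) ->
  exists2 C, 0 < C & forall H : m.-tuple X -> \bar R,
    measurable_fun setT H -> (forall t, 0 <= H t)%E ->
    exists h : X -> \bar R, [/\ measurable_fun setT h, (forall y, 0 <= h y)%E,
      (\int[mu]_y h y `^ p = \int[tuple_measure mu m]_t H t `^ p)%E &
      forall x, (\int[tuple_measure mu m]_t ((nearest k al be x t)%:E * H t) <=
        C%:E * \int[mu]_y
          ((rho x y `^ (- (p'^-1 + be + \sum_j (al j - p'^-1))))%:E * h y))%E].
Proof.
elim: m k al be => [[]//|m IH] k al be alp.
have al0 j : al j != 0 by rewrite gt_eqF// (lt_trans _ (alp j))// invr_gt0.
(* If [k] is not the first index, the first variable is integrated innermost, at radius rho x y_k.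
   The resulting power of that radius is absorbed into [be], and the induction hypothesis is applied
   to the slice norm [N]. *)
case: (unliftP ord0 k) => [k' ->|->].
  have [C C0 HC] := IH k' (fun j => al (lift ord0 j)) (be + (al ord0 - p'^-1))
    (fun j => alp _).
  have [D D0 HD] := ker_out_hoelder (alp ord0).
  exists (D * C); first exact: mulr_gt0.
  move=> H mH H0.
  have mHp : measurable_fun setT (fun t => H t `^ p)%E by exact: measurable_fun_poweR.
  have Hp0 t : (0 <= H t `^ p)%E by exact: poweR_ge0.
  pose N t := ((\int[mu]_y H (tcons (y, t)) `^ p) `^ p^-1)%E.
  have mN : measurable_fun setT N.
    by apply: measurable_fun_poweR; exact: (measurable_integral_tcons2 mu mHp Hp0).
  have N0 y : (0 <= N y)%E by exact: poweR_ge0.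
  have NE : (\int[tuple_measure mu m]_t N t `^ p =
      \int[tuple_measure mu m.+1]_t H t `^ p)%E.
    rewrite (integral_tcons2 mu mHp Hp0); apply: eq_integral => y _.
    by rewrite /N poweRK//; apply: integral_ge0 => t _; exact: poweR_ge0.
  have [h [mh h0 hN hle]] := HC N mN N0.
  exists h; split => //; first by rewrite hN NE.
  move=> x.
  have nearE y t : nearest (lift ord0 k') al be x (tcons (y, t)) =
      nearest k' (fun j => al (lift ord0 j)) be x t *
      ker_out (al ord0) (rho x (tnth t k')) x y.
    rewrite {1}/nearest big_ord_recl tnth_tcons0 tnth_tconsS.
    under eq_bigr do rewrite tnth_tconsS.
    by rewrite -mulrA mulrC.
  rewrite integral_tcons2; last 2 first.
  - by apply: emeasurable_funM => //; apply/measurable_EFinP; exact: measurable_nearest.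
  - by move=> t; rewrite mule_ge0// lee_fin nearest_ge0.
  apply: (@le_trans _ _ (\int[tuple_measure mu m]_t (D%:E * ((nearest k'
     (fun j => al (lift ord0 j)) (be + (al ord0 - p'^-1)) x t)%:E * N t)))%E).
    apply: ge0_le_integralT.
    + by move=> t; apply: integral_ge0 => y _; rewrite mule_ge0// lee_fin nearest_ge0.
    + apply: (@measurable_integral_tcons2 _ _ _ _ _ (fun t =>
        (nearest (lift ord0 k') al be x t)%:E * H t)%E).
        by apply: emeasurable_funM => //; apply/measurable_EFinP; exact: measurable_nearest.
      by move=> t; rewrite mule_ge0// lee_fin nearest_ge0.
    + apply: measurable_funeM; apply: emeasurable_funM => //.
      by apply/measurable_EFinP; exact: measurable_nearest.
    + move=> t; under eq_integral do rewrite nearE EFinM -muleA.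
      rewrite ge0_integralZl//; last 3 first.
      * apply: emeasurable_funM; last exact: measurable_tconsl.
        by apply/measurable_EFinP; exact: measurable_ker_out.
      * by move=> y _; rewrite mule_ge0// lee_fin ker_out_ge0.
      * by rewrite lee_fin nearest_ge0.
      (* Hoelder needs a positive radius; at radius 0 both sides vanish by the convention on powers
         of 0. *)
      have := rho_ge0 x (tnth t k'); rewrite le_eqVlt => /predU1P[r0|r0].
        by rewrite !nearest0// !mul0e mule0.
      apply: le_trans (lee_wpmul2l _ (HD x _ _ r0 _ _)) _ => //.
      * by rewrite lee_fin nearest_ge0.
      * exact: measurable_tconsl.
      rewrite -/(N t) !muleA -!EFinM lee_wpmul2r// lee_fin le_eqVlt.
      apply/orP; left; apply/eqP.
      rewrite /nearest [- (be + _)]opprD [X in _ = _ * (_ * X)]powRD; last first.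
        by rewrite (gt_eqF r0) implybT.
      ring.
  rewrite ge0_integralZl//; last 3 first.
  - apply: emeasurable_funM => //.
    by apply/measurable_EFinP; exact: measurable_nearest.
  - by move=> t _; rewrite mule_ge0// lee_fin nearest_ge0.
  - by rewrite lee_fin ltW.
  rewrite EFinM -muleA; apply: lee_wpmul2l; first by rewrite lee_fin ltW.
  apply: le_trans (hle x) _.
  by rewrite big_ord_recl !addrA.
(* If [k] is the first index, all the other variables are integrated out together, at radius
   [rho x y] with [y] the first entry. *)
have [D D0 HD] := ker_out_prod_hoelder
  (fun j : 'I_m => alp (lift ord0 j)).
exists D => // H mH H0.
have mHp : measurable_fun setT (fun t => H t `^ p)%E by exact: measurable_fun_poweR.
have Hp0 t : (0 <= H t `^ p)%E by exact: poweR_ge0.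
pose N y := ((\int[tuple_measure mu m]_t H (tcons (y, t)) `^ p) `^ p^-1)%E.
have mN : measurable_fun setT N.
  by apply: measurable_fun_poweR; exact: (measurable_integral_tcons1 mu mHp Hp0).
have N0 y : (0 <= N y)%E by exact: poweR_ge0.
have NE : (\int[mu]_t N t `^ p = \int[tuple_measure mu m.+1]_t H t `^ p)%E.
  rewrite (integral_tcons1 mu mHp Hp0); apply: eq_integral => y _.
  by rewrite /N poweRK//; apply: integral_ge0 => t _; exact: poweR_ge0.
exists N; split => // x.
have nearE y t : nearest ord0 al be x (tcons (y, t)) =
    rho x y `^ (- al ord0) * rho x y `^ (- be) *
    \prod_j ker_out (al (lift ord0 j)) (rho x y) x (tnth t j).
  rewrite /nearest big_ord_recl tnth_tcons0 ker_out_self mulrAC; congr (_ * _).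
  by apply: eq_bigr => j _; rewrite tnth_tconsS.
have mpow a : measurable_fun setT (fun y => (rho x y `^ a)%:E).
  by apply/measurable_EFinP/measurable_fun_powR; exact: measurable_rhor.
rewrite integral_tcons1; last 2 first.
- by apply: emeasurable_funM => //; apply/measurable_EFinP; exact: measurable_nearest.
- by move=> t; rewrite mule_ge0// lee_fin nearest_ge0.
rewrite -ge0_integralZl//; last 3 first.
- by apply: emeasurable_funM.
- by move=> y _; rewrite mule_ge0// lee_fin powR_ge0.
- by rewrite lee_fin ltW.
apply: ge0_le_integralT.
- by move=> t; apply: integral_ge0 => y _; rewrite mule_ge0// lee_fin nearest_ge0.
- apply: (@measurable_integral_tcons1 _ _ _ _ _ (fun t =>
    (nearest ord0 al be x t)%:E * H t)%E).
    by apply: emeasurable_funM => //; apply/measurable_EFinP; exact: measurable_nearest.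
  by move=> t; rewrite mule_ge0// lee_fin nearest_ge0.
- by apply: measurable_funeM; exact: emeasurable_funM.
move=> y.
have := rho_ge0 x y; rewrite le_eqVlt => /predU1P[r0|r0].
  under eq_integral do rewrite nearE -r0 powR0 ?oppr_eq0// !mul0r mul0e.
  by rewrite integral0 !mule_ge0// lee_fin ?powR_ge0// ltW.
under eq_integral do rewrite nearE EFinM -muleA.
rewrite ge0_integralZl//; last 3 first.
- apply: emeasurable_funM; last exact: measurable_tconsr.
  apply/measurable_EFinP; apply: measurable_prod => j _.
  by apply: (measurableT_comp (measurable_ker_out _ _ _)); exact: measurable_tnth.
- move=> t _; rewrite mule_ge0// lee_fin prodr_ge0// => j _; exact: ker_out_ge0.
- by rewrite lee_fin mulr_ge0 ?powR_ge0.
apply: le_trans (lee_wpmul2l _ (HD x _ _ r0 _ _)) _ => //.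
- by rewrite lee_fin mulr_ge0 ?powR_ge0.
- exact: measurable_tconsr.
rewrite -/(N y) !muleA -!EFinM lee_wpmul2r// lee_fin le_eqVlt.
apply/orP; left; apply/eqP.
rewrite mulrCA; congr (_ * _).
rewrite -!powRD ?(gt_eqF r0) ?implybT// big_ord_recl; congr (_ `^ _); lra.
Qed.

(** * The case m = 1: the Hardy-Littlewood-Sobolev inequality *)

Definition ker_in (al r : R) x y := if rho x y < r then rho x y `^ (- al) else 0.

Lemma ker_in_ge0 al r x y : 0 <= ker_in al r x y.
Proof. by rewrite /ker_in; case: ifP => // _; exact: powR_ge0. Qed.

Lemma measurable_ker_in al r x : measurable_fun setT (ker_in al r x).
Proof.
have mr := measurable_rhor x.
apply: measurable_fun_ifT => //; last exact: measurable_fun_powR.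
exact: (measurable_fun_ltr mr (measurable_cst r)).
Qed.

Lemma ker_in_integral (al : R) : 0 < al < 1 -> exists2 C, 0 < C &
  forall x r, 0 < r -> (\int[mu]_y (ker_in al r x y)%:E <= (C * r `^ (1 - al))%:E)%E.
Proof.
move=> al01; exists (c * (4 * (1 - 2 `^ (al - 1))^-1)).
  rewrite !mulr_gt0// invr_gt0 subr_gt0; apply: two_powR_lt1.
  by case/andP: al01 => a0 a1; lra.
move=> x r r0; rewrite -mulrA -mulrA [_^-1 * _]mulrC [4 * _]mulrA.
exact: (inner_integral_le (measurable_rhor x) (ltW c_gt0) (ball_rho x)
  (rho_ge0 x) al01 r0).
Qed.

Lemma ker_out_integral (al : R) : 1 < al -> exists2 C, 0 < C &
  forall x r, 0 < r ->
    (\int[mu]_y (ker_out al r x y)%:E <= (C * r `^ (1 - al))%:E)%E.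
Proof.
move=> a1; exists (c * (2 * (1 - 2 `^ (1 - al))^-1)).
  by rewrite !mulr_gt0// invr_gt0 subr_gt0; apply: two_powR_lt1; lra.
move=> x r r0; rewrite -mulrA -mulrA [_^-1 * _]mulrC [2 * _]mulrA.
exact: (outer_integral_le (measurable_rhor x) (ltW c_gt0) (ball_rho x) a1 r0).
Qed.

Let qV_lt_pV : q^-1 < p^-1. Proof. by rewrite ltf_pV2. Qed.

Let ea := p'^-1 + q^-1.
Let eb := 1 - q^-1.

Let eb_gt0 : 0 < eb.
Proof. by rewrite /eb subr_gt0 invf_lt1//; exact: lt_trans p_lt_q. Qed.

Let ea01 : 0 < ea < 1.
Proof.
by rewrite addr_gt0 ?invr_gt0//= /ea -pp' addrC ltrD2r.
Qed.

(** A weight that links F^q to h^p: its integral in [y] controls F^q ([hls_pointwise]), and its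
    integral in [x] is controlled by h^p ([w_integral]). The two entries of the minimum cross at rho
    = h^(-p). Below this radius the power of rho is [- ea] with [ea < 1], above it [- (ea + eb)]
    with [1 < ea + eb], so both ends are integrable. *)
Let w (h : X -> R) x y : R :=
  h y * (rho x y `^ (- ea) * Num.min (rho x y `^ (- eb)) (h y `^ (p * eb))).

Let w_ge0 h x y : (forall y, 0 <= h y) -> 0 <= w h x y.
Proof.
by move=> h0; rewrite /w mulr_ge0// mulr_ge0 ?powR_ge0// le_min !powR_ge0.
Qed.

Let measurable_w (h : X -> R) : measurable_fun setT h ->
  measurable_fun setT (fun z : X * X => w h z.1 z.2).
Proof.
move=> mh.
have mhz : measurable_fun setT (fun z : X * X => h z.2).
  exact: (measurableT_comp mh measurable_snd).
apply: measurable_funM => //; apply: measurable_funM.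
  exact: measurable_fun_powR.
by apply: measurable_minr; exact: measurable_fun_powR.
Qed.

Let measurable_wr (h : X -> R) x : measurable_fun setT h ->
  measurable_fun setT (w h x).
Proof.
by move=> mh; exact: (measurableT_comp (measurable_w mh) (pair1_measurable x)).
Qed.

(* A pointwise bound for the fractional integral F x: given a real 0 < t <= F x,
   cut the kernel at the radius r and h at the height tau for which the parts
   "rho >= r" and "rho < r, h <= tau" contribute at most t / 3 each. On the
   remaining part t is bounded by powers of rho and of h. *)
Lemma hls_pointwise : exists2 C, 0 < C & forall h : X -> R,
  measurable_fun setT h -> (forall y, 0 <= h y) ->
  (\int[mu]_y (h y `^ p)%:E <= 1)%E -> forall x,
  ((\int[mu]_y (rho x y `^ (- ea) * h y)%:E) `^ q <=
    C%:E * \int[mu]_y (w h x y)%:E)%E.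
Proof.
have [C1 C10 HC1] := ker_in_integral ea01.
have pal : p'^-1 < ea by rewrite ltrDl invr_gt0.
have [CH CH0 HCH] := ker_out_hoelder pal.
(* [D] is the constant for which [tau] below equals t^(q/p) / D. [C3] dominates the constants of
   both [tpow] and [hpow]. *)
pose D := 3 * C1 * (3 * CH) `^ (q / p - 1).
have D0 : 0 < D by rewrite !mulr_gt0 ?powR_gt0// mulr_gt0.
pose C3 := (3 * CH) `^ (q - 1) + D `^ (p * eb).
have C30 : 0 < C3 by rewrite addr_gt0 ?powR_gt0// mulr_gt0.
exists (3 * C3); first exact: mulr_gt0.
move=> h mh h0 h1 x.
apply: poweR_le_of_real => //.
- by apply: integral_ge0 => y _; rewrite lee_fin mulr_ge0 ?powR_ge0.
- rewrite mule_ge0//; first by rewrite lee_fin mulr_ge0// ltW.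
  by apply: integral_ge0 => y _; rewrite lee_fin w_ge0.
move=> t t0 tF.
(* [r] solves CH r^(-1/q) = t / 3, which settles the far part; then [tau] solves tau C1 r^(1 - ea) =
   t / 3, which settles the near part with [h] at most [tau]. *)
pose r := (3 * CH / t) `^ q.
have CHt0 : 0 < 3 * CH / t by rewrite divr_gt0 ?mulr_gt0.
have r0 : 0 < r by exact: powR_gt0.
pose tau := t / (3 * C1 * r `^ (1 - ea)).
have tau0 : 0 < tau by rewrite divr_gt0// !mulr_gt0 ?powR_gt0.
(* The three terms belong to the three regions. On the last one, [rho x y < r] gives [tpow] and
   [tau < h y] gives [hpow]; together they bound t^(q - 1) by [C3] times the minimum in [w]. *)
have ptw y : rho x y `^ (- ea) * h y <= ker_out ea r x y * h y +
    (tau * ker_in ea r x y + C3 * t `^ (1 - q) * w h x y).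
  have k0 : 0 <= rho x y `^ (- ea) by exact: powR_ge0.
  have third_ge0 : 0 <= C3 * t `^ (1 - q) * w h x y.
    by rewrite mulr_ge0 ?w_ge0// mulr_ge0 ?powR_ge0// ltW.
  rewrite /ker_out /ker_in; case: leP => [_|rhor].
    by rewrite lerDl mulr0 add0r.
  rewrite mul0r add0r; case: (leP (h y) tau) => [htau|tauh].
    by rewrite mulrC (le_trans (ler_wpM2r k0 htau))// lerDl.
  apply: (@le_trans _ _ (C3 * t `^ (1 - q) * w h x y)); last first.
    by rewrite lerDr mulr_ge0// ltW.
  have [rho0|rhoN0] := eqVneq (rho x y) 0.
    rewrite rho0 powR0 ?mul0r ?oppr_eq0 ?gt_eqF//; last by case/andP: ea01.
  have {}rhoN0 : 0 < rho x y by rewrite lt_neqAle eq_sym rhoN0 rho_ge0.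
  rewrite /w mulrC [leRHS]mulrCA ler_wpM2l//.
  rewrite [leRHS]mulrCA -[leLHS]mulr1 ler_wpM2l//.
  have -> : t `^ (1 - q) = (t `^ (q - 1))^-1 by rewrite -powRN opprB.
  rewrite mulrAC ler_pdivlMr ?powR_gt0// mul1r.
  have q10 : 0 <= q - 1 by rewrite subr_ge0 ltW// (lt_trans p_gt1).
  have tpow : t `^ (q - 1) <= (3 * CH) `^ (q - 1) * rho x y `^ (- eb).
    have -> : - eb = - q^-1 * (q - 1).
      by rewrite /eb mulrBr mulNr mulVf ?gt_eqF//; lra.
    rewrite powRrM -powRM ?powR_ge0 ?mulr_ge0 ?(ltW CH0)//.
    apply: ge0_ler_powR => //; rewrite ?nnegrE ?mulr_ge0 ?powR_ge0 ?(ltW CH0) ?(ltW t0)//.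
    rewrite powRN ler_pdivlMr ?powR_gt0// mulrC -ler_pdivlMr//.
    have -> : 3 * CH / t = r `^ q^-1.
      by rewrite /r -powRrM mulfV ?gt_eqF// powRr1// ltW.
    apply: ge0_ler_powR; rewrite ?nnegrE ?invr_ge0 ?(ltW q_gt0) ?(ltW r0) ?(ltW rhor)//.
  have hpow : t `^ (q - 1) <= D `^ (p * eb) * h y `^ (p * eb).
    have -> : q - 1 = q / p * (p * eb).
      by rewrite /eb; field; rewrite !gt_eqF.
    rewrite powRrM -powRM ?(ltW D0)//.
    apply: ge0_ler_powR; rewrite ?nnegrE ?powR_ge0//.
    - by rewrite mulr_ge0// ltW.
    - by rewrite mulr_ge0// ltW.
    rewrite [leRHS]mulrC -ler_pdivrMr//; apply: le_trans (ltW tauh).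
    rewrite le_eqVlt; apply/orP; left; apply/eqP.
    rewrite /tau /D /r -powRrM.
    have -> : q * (1 - ea) = q / p - 1.
      have -> : 1 - ea = p^-1 - q^-1 by rewrite /ea -pp'; lra.
      by rewrite mulrBr mulfV ?gt_eqF.
    rewrite [(3 * CH / t) `^ _]powRM ?invr_ge0 ?(ltW t0) ?mulr_ge0 ?(ltW CH0)//.
    rewrite -[t^-1 in RHS]powR_inv1 ?(ltW t0)// -powRrM mulN1r.
    have tqp : t `^ (q / p) = t * t `^ (q / p - 1).
      by rewrite mulr_powRB1 ?(ltW t0)// divr_gt0.
    rewrite tqp powRN; field.
    by rewrite !gt_eqF ?powR_gt0// mulr_gt0.
  apply: (@le_trans _ _ (C3 * Num.min (rho x y `^ (- eb)) (h y `^ (p * eb)))); last by [].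
  rewrite minr_pMr ?(ltW C30)// le_min; apply/andP; split.
    by rewrite (le_trans tpow)// ler_wpM2r ?powR_ge0// lerDl powR_ge0.
  by rewrite (le_trans hpow)// ler_wpM2r ?powR_ge0// lerDr powR_ge0.
have mw := measurable_wr x mh.
have w0 y : (0 <= (w h x y)%:E)%E by rewrite lee_fin w_ge0.
have mhead : measurable_fun setT (fun y => (ker_in ea r x y)%:E).
  by apply/measurable_EFinP; exact: measurable_ker_in.
have split3 : (t%:E <= \int[mu]_y ((ker_out ea r x y)%:E * (h y)%:E) +
    (tau%:E * \int[mu]_y (ker_in ea r x y)%:E +
     (C3 * t `^ (1 - q))%:E * \int[mu]_y (w h x y)%:E))%E.
  have E0 : 0 <= C3 * t `^ (1 - q) by rewrite mulr_ge0 ?powR_ge0// ltW.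
  apply: (le_trans tF).
  have mtailh : measurable_fun setT (fun y => (ker_out ea r x y)%:E * (h y)%:E)%E.
    by apply: emeasurable_funM; apply/measurable_EFinP => //; exact: measurable_ker_out.
  have mheadt : measurable_fun setT (fun y => tau%:E * (ker_in ea r x y)%:E)%E.
    exact: measurable_funeM.
  have mwC : measurable_fun setT
      (fun y => (C3 * t `^ (1 - q))%:E * (w h x y)%:E)%E.
    by apply: measurable_funeM; apply/measurable_EFinP.
  have tailh0 y : (0 <= (ker_out ea r x y)%:E * (h y)%:E)%E.
    by rewrite mule_ge0 ?lee_fin ?ker_out_ge0.
  have headt0 y : (0 <= tau%:E * (ker_in ea r x y)%:E)%E.
    by rewrite mule_ge0 ?lee_fin ?ker_in_ge0// ltW.
  have wC0 y : (0 <= (C3 * t `^ (1 - q))%:E * (w h x y)%:E)%E.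
    by rewrite mule_ge0.
  rewrite -ge0_integralZl//; last 2 first.
  - by move=> y _; rewrite lee_fin ker_in_ge0.
  - by rewrite lee_fin ltW.
  rewrite -ge0_integralZl//; last by apply/measurable_EFinP.
  rewrite -ge0_integralD// -ge0_integralD//; last 2 first.
  - by move=> y _; rewrite adde_ge0.
  - exact: emeasurable_funD.
  apply: ge0_le_integralT.
  - by move=> y; rewrite lee_fin mulr_ge0 ?powR_ge0.
  - apply/measurable_EFinP; apply: measurable_funM => //.
    by apply: measurable_fun_powR; exact: measurable_rhor.
  - by apply: emeasurable_funD => //; exact: emeasurable_funD.
  - by move=> y; rewrite -!EFinM -!EFinD lee_fin.
have tailE : (\int[mu]_y ((ker_out ea r x y)%:E * (h y)%:E) <= (t / 3)%:E)%E.
  have mhE : measurable_fun setT (fun y => (h y)%:E) by exact/measurable_EFinP.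
  have hE0 y : (0 <= (h y)%:E)%E by rewrite lee_fin.
  apply: le_trans (HCH x r _ r0 mhE hE0) _.
  have -> : CH * r `^ (- (ea - p'^-1)) = t / 3.
    have -> : ea - p'^-1 = q^-1 by rewrite /ea; lra.
    rewrite powRN /r -powRrM mulfV ?gt_eqF// powRr1 ?(ltW CHt0)//.
    by field; rewrite !gt_eqF.
  rewrite -[leRHS]mule1 lee_wpmul2l//; first by rewrite lee_fin divr_ge0// ltW.
  rewrite -(poweR1r p^-1); apply: le_poweR => //; first by rewrite invr_ge0 ltW.
  by apply: integral_ge0 => y _; exact: poweR_ge0.
have headE : (tau%:E * \int[mu]_y (ker_in ea r x y)%:E <= (t / 3)%:E)%E.
  apply: le_trans (lee_wpmul2l _ (HC1 x r r0)) _; first by rewrite lee_fin ltW.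
  rewrite -EFinM lee_fin le_eqVlt; apply/orP; left; apply/eqP.
  by rewrite /tau; field; rewrite !gt_eqF ?powR_gt0.
have [Woo|] := eqVneq (\int[mu]_y (w h x y)%:E)%E +oo%E.
  by rewrite Woo gt0_muley ?leey// lte_fin mulr_gt0.
have : (0 <= \int[mu]_y (w h x y)%:E)%E by exact: integral_ge0.
move: split3; case: (\int[mu]_y (w h x y)%:E)%E => // W split3 W0 _.
have : (t%:E <= (t / 3)%:E + ((t / 3)%:E + (C3 * t `^ (1 - q))%:E * W%:E))%E.
  by apply: (le_trans split3); rewrite leeD// leeD.
rewrite -!EFinM -!EFinD !lee_fin => tW.
(* The first two parts take up at most 2t / 3, so the third is at least t / 3. Multiplying by t^(q -
   1) gives the claim. *)
have {}tW : t <= 3 * (C3 * t `^ (1 - q) * W) by lra.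
rewrite -(mulr_powRB1 (ltW t0) q_gt0).
apply: (le_trans (ler_wpM2r (powR_ge0 _ _) tW)).
have -> : t `^ (1 - q) = (t `^ (q - 1))^-1 by rewrite -powRN opprB.
rewrite le_eqVlt; apply/orP; left; apply/eqP.
by field; rewrite gt_eqF ?powR_gt0.
Qed.

(** Split at the crossing radius r = h(y)^(-p). Since ea + eb - 1 = 1/p' and p / p' = p - 1, the
    inner and the outer integral both scale like h(y)^(p - 1), and the remaining factor [h y]
    completes the power. *)
Lemma w_integral : exists2 C, 0 < C & forall h : X -> R,
  measurable_fun setT h -> (forall y, 0 <= h y) -> forall y,
  (\int[mu]_x (w h x y)%:E <= (C * h y `^ p)%:E)%E.
Proof.
have [C1 C10 HC1] := ker_in_integral ea01.
have al1 : 1 < ea + eb by rewrite (_ : ea + eb = 1 + p'^-1) ?ltrDl ?invr_gt0// /ea /eb; lra.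
have [C2 C20 HC2] := ker_out_integral al1.
exists (C1 + C2); first exact: addr_gt0.
move=> h mh h0 y.
have := h0 y; rewrite le_eqVlt => /predU1P[hy|hy].
  under eq_integral do rewrite /w -hy mul0r.
  by rewrite integral0 lee_fin mulr_ge0 ?powR_ge0// ltW// addr_gt0.
pose r := h y `^ (- p).
have r0 : 0 < r by exact: powR_gt0.
apply: (@le_trans _ _ (\int[mu]_x ((h y * h y `^ (p * eb))%:E * (ker_in ea r y x)%:E
    + (h y)%:E * (ker_out (ea + eb) r y x)%:E)%E)%E).
  apply: ge0_le_integralT.
  - by move=> x; rewrite lee_fin w_ge0.
  - apply/measurable_EFinP.
    exact: (measurableT_comp (measurable_w mh) (pair2_measurable y)).
  - apply: emeasurable_funD; apply: measurable_funeM; apply/measurable_EFinP.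
      exact: measurable_ker_in.
    exact: measurable_ker_out.
  - move=> x; rewrite -!EFinM -EFinD lee_fin /w rhoC -mulrA -mulrDr ler_wpM2l//.
    rewrite /ker_out /ker_in; case: ltP => _.
      by rewrite addr0 mulrC ler_wpM2r ?powR_ge0// ge_min lexx orbT.
    rewrite mulr0 add0r; have [->|rho0] := eqVneq (rho y x) 0.
      rewrite powR0 ?mul0r ?powR_ge0// oppr_eq0 gt_eqF//.
      by case/andP: ea01.
    rewrite [- (ea + eb)]opprD [_ `^ (- ea - eb)]powRD ?rho0 ?implybT// ler_wpM2l ?powR_ge0//.
    by rewrite ge_min lexx.
rewrite ge0_integralD//; last 4 first.
- by move=> x _; rewrite mule_ge0 ?lee_fin ?ker_in_ge0 ?mulr_ge0 ?powR_ge0.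
- by apply: measurable_funeM; apply/measurable_EFinP; exact: measurable_ker_in.
- by move=> x _; rewrite mule_ge0 ?lee_fin ?ker_out_ge0.
- by apply: measurable_funeM; apply/measurable_EFinP; exact: measurable_ker_out.
rewrite !ge0_integralZl//; last 6 first.
- by apply/measurable_EFinP; exact: measurable_ker_out.
- by move=> x _; rewrite lee_fin ker_out_ge0.
- by rewrite lee_fin.
- by apply/measurable_EFinP; exact: measurable_ker_in.
- by move=> x _; rewrite lee_fin ker_in_ge0.
- by rewrite lee_fin mulr_ge0// powR_ge0.
apply: le_trans (leeD (lee_wpmul2l _ (HC1 y r r0)) (lee_wpmul2l _ (HC2 y r r0))) _.
- by rewrite lee_fin mulr_ge0// powR_ge0.
- by rewrite lee_fin.
rewrite -!EFinM -EFinD lee_fin mulrDl le_eqVlt; apply/orP; left; apply/eqP.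
have hN0 : (h y == 0) = false by rewrite gt_eqF.
have pVp' : p / p' = p - 1.
  have -> : p'^-1 = 1 - p^-1 by rewrite -pp' addrAC subrr add0r.
  by rewrite mulrBr mulr1 mulfV ?gt_eqF.
have e1 : h y `^ (p * eb) * r `^ (1 - ea) = h y `^ (p - 1).
  rewrite /r -powRrM -powRD ?hN0 ?implybT//; congr (_ `^ _).
  by rewrite -pVp' /eb /ea; ring.
have e2 : r `^ (1 - (ea + eb)) = h y `^ (p - 1).
  rewrite /r -powRrM; congr (_ `^ _).
  by rewrite -pVp' /eb /ea; ring.
rewrite -(mulr_powRB1 (ltW hy) p_gt0) e2 -e1; ring.
Qed.

Lemma measurable_frac_int (h : X -> R) : measurable_fun setT h ->
  (forall y, 0 <= h y) ->
  measurable_fun setT (fun x => \int[mu]_y (rho x y `^ (- ea) * h y)%:E)%E.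
Proof.
move=> mh h0.
apply: (@measurable_fun_fubini_tonelli_F _ _ _ _ _ mu
  (fun z : X * X => (rho z.1 z.2 `^ (- ea) * h z.2)%:E)).
  apply/measurable_EFinP; apply: measurable_funM.
    exact: measurable_fun_powR.
  exact: (measurableT_comp mh measurable_snd).
by move=> z; rewrite lee_fin mulr_ge0 ?powR_ge0.
Qed.

(** Integrate the pointwise bound in [x], exchange the integrals, and apply [w_integral] for each
    [y]. *)
Lemma hls_normalized : exists2 C, 0 < C & forall h : X -> R,
  measurable_fun setT h -> (forall y, 0 <= h y) ->
  (\int[mu]_y (h y `^ p)%:E <= 1)%E ->
  (\int[mu]_x (\int[mu]_y (rho x y `^ (- ea) * h y)%:E) `^ q <= C%:E)%E.
Proof.
have [C C0 HC] := hls_pointwise; have [D D0 HD] := w_integral.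
exists (C * D); first exact: mulr_gt0.
move=> h mh h0 h1.
have mwz : measurable_fun setT (fun z : X * X => (w h z.1 z.2)%:E).
  by apply/measurable_EFinP; exact: measurable_w.
have wz0 (z : X * X) : (0 <= (w h z.1 z.2)%:E)%E by rewrite lee_fin w_ge0.
have mF := measurable_frac_int mh h0.
have mG := measurable_fun_fubini_tonelli_F (m2 := mu) _ mwz wz0.
apply: (@le_trans _ _ (\int[mu]_x (C%:E * \int[mu]_y (w h x y)%:E))%E).
  apply: ge0_le_integralT.
  - by move=> x; exact: poweR_ge0.
  - exact: measurable_fun_poweR.
  - exact: measurable_funeM.
  - by move=> x; exact: HC.
rewrite ge0_integralZl//; last 2 first.
- by move=> x _; apply: integral_ge0 => y _; rewrite lee_fin w_ge0.
- by rewrite lee_fin ltW.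
rewrite EFinM; apply: lee_wpmul2l; first by rewrite lee_fin ltW.
rewrite (fubini_tonelli _ mwz wz0)/=.
apply: (@le_trans _ _ (\int[mu]_y (D%:E * (h y `^ p)%:E))%E).
  apply: ge0_le_integralT.
  - by move=> y; apply: integral_ge0 => x _; rewrite lee_fin w_ge0.
  - exact: (measurable_fun_fubini_tonelli_G (m1 := mu) _ mwz wz0).
  - by apply: measurable_funeM; apply/measurable_EFinP; exact: measurable_fun_powR.
  - by move=> y; rewrite -EFinM; exact: HD.
rewrite ge0_integralZl//; last 3 first.
- by apply/measurable_EFinP; exact: measurable_fun_powR.
- by move=> y _; rewrite lee_fin powR_ge0.
- by rewrite lee_fin ltW.
by rewrite -[leRHS]mule1; apply: lee_wpmul2l => //; rewrite lee_fin ltW.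
Qed.

(** Apply the normalized case to [fine (h y) / A], which agrees with h / A almost everywhere. A
    positive bound [A] in place of the norm itself keeps the division legitimate when the norm is
    0. *)
Lemma hls : exists2 C, 0 < C & forall (h : X -> \bar R) A,
  measurable_fun setT h -> (forall y, 0 <= h y)%E -> 0 < A ->
  (\int[mu]_y h y `^ p <= (A `^ p)%:E)%E ->
  (\int[mu]_x (\int[mu]_y ((rho x y `^ (- ea))%:E * h y)) `^ q <=
    (C * A `^ q)%:E)%E.
Proof.
have [C C0 HC] := hls_normalized; exists C => // h A mh h0 A0 hA.
have hfin : {ae mu, forall y, h y \is a fin_num}.
  by apply: (ae_fin_of_integral_lty mh h0 p_gt0); rewrite (le_lt_trans hA) ?ltry.
pose g y := fine (h y) / A.
have mg : measurable_fun setT g.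
  by apply: measurable_funM => //; exact: measurableT_comp.
have g0 y : 0 <= g y by rewrite divr_ge0 ?(ltW A0)//; exact: fine_ge0.
have hE : {ae mu, forall y, h y = A%:E * (g y)%:E}%E.
  apply: filterS hfin => y hy.
  by rewrite -EFinM /g mulrC divfK ?gt_eqF// fineK.
have g1 : (\int[mu]_y (g y `^ p)%:E <= 1)%E.
  rewrite (_ : (1 = (A `^ (- p))%:E * (A `^ p)%:E)%E); last first.
    by rewrite -EFinM powRN mulVf// gt_eqF ?powR_gt0.
  apply: (@le_trans _ _ ((A `^ (- p))%:E * \int[mu]_y h y `^ p)%E); last first.
    by apply: lee_wpmul2l => //; rewrite lee_fin powR_ge0.
  rewrite -ge0_integralZl//; last 3 first.
  - exact: measurable_fun_poweR.
  - by move=> y _; exact: poweR_ge0.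
  - by rewrite lee_fin powR_ge0.
  apply: ae_ge0_le_integral => //.
  - by move=> y _; rewrite lee_fin powR_ge0.
  - by apply/measurable_EFinP; exact: measurable_fun_powR.
  - by move=> y _; rewrite mule_ge0 ?lee_fin ?powR_ge0 ?poweR_ge0.
  - by apply: measurable_funeM; exact: measurable_fun_poweR.
  - apply: filterS hE => y -> _.
    rewrite -EFinM lee_fin [(A * _) `^ _]powRM ?(ltW A0)//.
    by rewrite mulrA powRN mulVf ?mul1r// gt_eqF ?powR_gt0.
have IE x : (\int[mu]_y ((rho x y `^ (- ea))%:E * h y) =
    A%:E * \int[mu]_y (rho x y `^ (- ea) * g y)%:E)%E.
  have mk : measurable_fun setT (fun y => rho x y `^ (- ea)).
    by apply: measurable_fun_powR; exact: measurable_rhor.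
  rewrite -ge0_integralZl//; last 3 first.
  - by apply/measurable_EFinP; exact: measurable_funM.
  - by move=> y _; rewrite lee_fin (mulr_ge0 (powR_ge0 _ _) (g0 y)).
  - by rewrite lee_fin ltW.
  apply: ge0_ae_eq_integral => //.
  - by apply: emeasurable_funM => //; apply/measurable_EFinP.
  - by apply: measurable_funeM; apply/measurable_EFinP; exact: measurable_funM.
  - by move=> y _; rewrite mule_ge0 ?lee_fin ?powR_ge0 ?h0.
  - move=> y _; rewrite mule_ge0 ?lee_fin ?(ltW A0)//.
    exact: mulr_ge0 (powR_ge0 _ _) (g0 y).
  - by apply: filterS hE => y -> _; rewrite EFinM muleCA.
have I0 x : (0 <= \int[mu]_y (rho x y `^ (- ea) * g y)%:E)%E.
  by apply: integral_ge0 => y _; rewrite lee_fin (mulr_ge0 (powR_ge0 _ _) (g0 y)).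
under eq_integral do rewrite IE poweRM ?lee_fin ?(ltW A0)//.
rewrite ge0_integralZl//; last 3 first.
- by apply: measurable_fun_poweR; exact: measurable_frac_int.
- by move=> x _; exact: poweR_ge0.
- by rewrite poweR_ge0.
rewrite mulrC EFinM; apply: lee_wpmul2l; first by rewrite lee_fin powR_ge0.
exact: HC.
Qed.

(** * The multilinear inequality under the ball condition *)

(** For an index [k0] minimizing the distance no factor is truncated, so the term of [k0] is the
    whole kernel; the other terms are nonnegative. *)
Lemma kernel_le_sum_nearest m (al : 'I_m -> R) x (t : m.-tuple X) : (0 < m)%N ->
  \prod_j rho x (tnth t j) `^ (- al j) <= \sum_k nearest k al 0 x t.
Proof.
case: m al t => // m al t _.
pose k0 := [arg min_(k < ord0) rho x (tnth t k)]%O.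
have rk0 k : rho x (tnth t k0) <= rho x (tnth t k).
  by rewrite /k0; case: Order.TotalTheory.arg_minP => // i _; exact.
rewrite [leRHS](bigD1 k0)//= -[leLHS]addr0; apply: lerD.
  rewrite /nearest oppr0 powRr0 mulr1 le_eqVlt; apply/orP; left; apply/eqP.
  by apply: eq_bigr => j _; rewrite /ker_out rk0.
by apply: sumr_ge0 => k _; exact: nearest_ge0.
Qed.

(** The scaling condition turns the exponent of [nearest_le_hls] with [be = 0] into 1/p' + 1/q, the
    one in [hls]. The [m] pieces are then recombined by [poweR_sum_le]. *)
Lemma multilinear_hls m (al : 'I_m -> R) : (0 < m)%N ->
  (forall j, p'^-1 < al j) -> \sum_j (al j - p'^-1) = q^-1 ->
  exists2 C, 0 < C & forall (H : m.-tuple X -> \bar R) A,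
    measurable_fun setT H -> (forall t, 0 <= H t)%E -> 0 < A ->
    (\int[tuple_measure mu m]_t H t `^ p <= (A `^ p)%:E)%E ->
    (\int[mu]_x (\int[tuple_measure mu m]_t
        ((\prod_j rho x (tnth t j) `^ (- al j))%:E * H t)) `^ q <=
      (C * A `^ q)%:E)%E.
Proof.
move=> m0 alp alq.
have [C C0 HC] := hls.
have nearD k : exists2 D, 0 < D & forall H : m.-tuple X -> \bar R,
    measurable_fun setT H -> (forall t, 0 <= H t)%E ->
    exists h : X -> \bar R, [/\ measurable_fun setT h, (forall y, 0 <= h y)%E,
      (\int[mu]_y h y `^ p = \int[tuple_measure mu m]_t H t `^ p)%E &
      forall x, (\int[tuple_measure mu m]_t ((nearest k al 0 x t)%:E * H t) <=
        D%:E * \int[mu]_y ((rho x y `^ (- (p'^-1 + q^-1)))%:E * h y))%E].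
  have := nearest_le_hls k 0 alp.
  by rewrite addr0 alq.
(* The constants [D k] are fixed before [H] is introduced, so the final constant does not depend on
   [H]; the functions [h k] are chosen afterwards. *)
pose D k := sval (cid2 (nearD k)).
have D0 k : 0 < D k by rewrite /D; case: cid2.
have DC0 k : 0 <= D k `^ q * C by rewrite mulr_ge0 ?powR_ge0// ltW.
have sum0 : 0 <= m%:R `^ q * \sum_k (D k `^ q * C).
  by rewrite mulr_ge0 ?powR_ge0 ?sumr_ge0.
(* The [+ 1] gives positivity at once from the nonnegativity of the sum. *)
exists (m%:R `^ q * \sum_k (D k `^ q * C) + 1); first by rewrite ltr_wpDl.
move=> H A mH H0 A0 HA.
have hk k : exists h : X -> \bar R, [/\ measurable_fun setT h,
    (forall y, 0 <= h y)%E,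
    (\int[mu]_y h y `^ p = \int[tuple_measure mu m]_t H t `^ p)%E &
    forall x, (\int[tuple_measure mu m]_t ((nearest k al 0 x t)%:E * H t) <=
      (D k)%:E * \int[mu]_y ((rho x y `^ (- (p'^-1 + q^-1)))%:E * h y))%E].
  by rewrite /D; case: cid2 => /= Dk _ HD; exact: HD.
pose h k := sval (cid (hk k)).
have mh k : measurable_fun setT (h k) by rewrite /h; case: cid => ? [].
have h0 k y : (0 <= h k y)%E by rewrite /h; case: cid => ? [].
have hA k : (\int[mu]_y h k y `^ p <= (A `^ p)%:E)%E.
  by rewrite /h; case: cid => ? /= [_ _ -> _].
pose I k x := (\int[mu]_y ((rho x y `^ (- (p'^-1 + q^-1)))%:E * h k y))%E.
have hI k x : (\int[tuple_measure mu m]_t ((nearest k al 0 x t)%:E * H t) <=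
    (D k)%:E * I k x)%E by rewrite /I /h; case: cid => ? /= [].
have I0 k x : (0 <= I k x)%E.
  by apply: integral_ge0 => y _; rewrite mule_ge0// lee_fin powR_ge0.
have mI k : measurable_fun setT (I k).
  apply: (@measurable_fun_fubini_tonelli_F _ _ _ _ _ mu
    (fun z : X * X => (rho z.1 z.2 `^ (- (p'^-1 + q^-1)))%:E * h k z.2)%E).
    apply: emeasurable_funM.
      by apply/measurable_EFinP; exact: measurable_fun_powR.
    exact: (measurableT_comp (mh k) measurable_snd).
  by move=> z; rewrite mule_ge0// lee_fin powR_ge0.
pose K x (t : m.-tuple X) := \prod_j rho x (tnth t j) `^ (- al j).
have K0 x t : 0 <= K x t by rewrite prodr_ge0// => j _; exact: powR_ge0.
have mK : measurable_fun setT (fun z : X * m.-tuple X => K z.1 z.2).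
  apply: measurable_prod => j _; apply: measurable_fun_powR.
  have mpair : measurable_fun setT (fun z : X * m.-tuple X => (z.1, tnth z.2 j)).
    apply: measurable_fun_pair; first exact: measurable_fst.
    exact: (measurableT_comp (measurable_tnth j) measurable_snd).
  exact: (measurableT_comp mrho mpair).
have mF : measurable_fun setT
    (fun x => \int[tuple_measure mu m]_t ((K x t)%:E * H t))%E.
  apply: (@measurable_fun_fubini_tonelli_F _ _ _ _ _ (tuple_measure mu m)
    (fun z : X * m.-tuple X => (K z.1 z.2)%:E * H z.2)%E).
    apply: emeasurable_funM; first by apply/measurable_EFinP.
    exact: (measurableT_comp mH measurable_snd).
  by move=> z; rewrite mule_ge0// lee_fin.
have F0 x : (0 <= \int[tuple_measure mu m]_t ((K x t)%:E * H t))%E.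
  by apply: integral_ge0 => t _; rewrite mule_ge0// lee_fin.
have FI x : (\int[tuple_measure mu m]_t ((K x t)%:E * H t) <=
    \sum_k (D k)%:E * I k x)%E.
  have mnearD k : measurable_fun setT
      (fun t => (nearest k al 0 x t)%:E * H t)%E.
    by apply: emeasurable_funM => //; apply/measurable_EFinP; exact: measurable_nearest.
  have near0 k t : (0 <= (nearest k al 0 x t)%:E * H t)%E.
    by rewrite mule_ge0// lee_fin nearest_ge0.
  apply: (@le_trans _ _ (\sum_k
      \int[tuple_measure mu m]_t ((nearest k al 0 x t)%:E * H t))%E); last first.
    by apply: lee_sum => k _; exact: hI.
  rewrite -ge0_integral_sum//; apply: ge0_le_integralT.
  - by move=> t; rewrite mule_ge0// lee_fin.
  - apply: emeasurable_funM => //; apply/measurable_EFinP.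
    exact: (measurableT_comp mK (pair1_measurable x)).
  - exact: emeasurable_sum.
  - move=> t; rewrite -ge0_sume_distrl; last first.
      by move=> k _; rewrite lee_fin nearest_ge0.
    by rewrite sumEFin lee_wpmul2r// lee_fin kernel_le_sum_nearest.
apply: (@le_trans _ _ (\int[mu]_x
    ((m%:R `^ q)%:E * \sum_k ((D k `^ q)%:E * I k x `^ q)))%E).
  apply: ge0_le_integralT.
  - by move=> x; exact: poweR_ge0.
  - exact: measurable_fun_poweR.
  - apply: measurable_funeM; apply: emeasurable_sum => k.
    by apply: measurable_funeM; exact: measurable_fun_poweR.
  - move=> x; apply: (@le_trans _ _ ((\sum_k (D k)%:E * I k x) `^ q)%E).
      by apply: le_poweR; [exact: ltW|exact: F0|exact: FI].
    apply: (le_trans (poweR_sum_le q_gt0 _)).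
      by move=> k; rewrite mule_ge0// lee_fin ltW.
    apply: lee_wpmul2l; first by rewrite lee_fin powR_ge0.
    by apply: lee_sum => k _; rewrite poweRM ?lee_fin ?(ltW (D0 k)).
rewrite ge0_integralZl//; last 2 first.
- by apply: emeasurable_sum => k; apply: measurable_funeM; exact: measurable_fun_poweR.
- move=> x _; apply: sume_ge0 => k _.
  by rewrite mule_ge0 ?poweR_ge0// lee_fin powR_ge0.
rewrite ge0_integral_sum//; last 2 first.
- by move=> k; apply: measurable_funeM; exact: measurable_fun_poweR.
- by move=> k x _; rewrite mule_ge0 ?poweR_ge0// lee_fin powR_ge0.
apply: (@le_trans _ _ ((m%:R `^ q)%:E * \sum_k ((D k `^ q)%:E * (C * A `^ q)%:E))%E).
  apply: lee_wpmul2l; first by rewrite lee_fin powR_ge0.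
  apply: lee_sum => k _; rewrite ge0_integralZl//; last 3 first.
  - exact: measurable_fun_poweR.
  - by move=> x _; exact: poweR_ge0.
  - by rewrite lee_fin powR_ge0.
  by apply: lee_wpmul2l; [rewrite lee_fin powR_ge0|exact: HC].
under eq_bigr do rewrite -EFinM mulrA.
rewrite sumEFin -EFinM lee_fin -[in leLHS]mulr_suml [leLHS]mulrA.
by rewrite ler_wpM2r ?powR_ge0// lerDl.
Qed.

End ball_growth.

(** * Euclidean balls satisfy the ball condition *)

Section euclidean.
Variable R : realType.

Lemma edist_ge0 n (x y : Rn R n) : 0 <= Defs.edist x y.
Proof. exact: sqrtr_ge0. Qed.

Lemma edistC n (x y : Rn R n) : Defs.edist x y = Defs.edist y x.
Proof.
by congr Num.sqrt; apply: eq_bigr => i _; rewrite -sqrrN opprB.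
Qed.

Lemma measurable_edist n :
  measurable_fun setT (fun z : Rn R n * Rn R n => Defs.edist z.1 z.2).
Proof.
apply: measurableT_comp.
  by apply: continuous_measurable_fun; exact: sqrt_continuous.
apply: measurable_sum => i; apply: measurable_funX; apply: measurable_funB.
- exact: (measurableT_comp (measurable_tnth i) measurable_fst).
- exact: (measurableT_comp (measurable_tnth i) measurable_snd).
Qed.

Lemma coord_le_edist n (x y : Rn R n) (i : 'I_n) :
  `|(tnth x i : R) - (tnth y i : R)| <= Defs.edist x y.
Proof.
rewrite -sqrtr_sqr; apply: ler_wsqrtr.
by rewrite (bigD1 i)//= lerDl sumr_ge0// => j _; exact: sqr_ge0.
Qed.

(** The ball of radius e = r^(1/n) lies in the cube of side 2e with the same centre, whose measure
    is (2e)^n = 2^n r. *)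
Lemma edist_ball_le n (x : Rn R n) (r : R) : (0 < n)%N -> 0 < r ->
  (lebesgueRn R n [set y | (Defs.edist x y ^+ n < r)%R] <= (2 ^+ n * r)%:E)%E.
Proof.
move=> n0 r0.
pose e := r `^ (n%:R^-1).
have e0 : 0 < e by exact: powR_gt0.
have en : e ^+ n = r.
  rewrite -powR_mulrn ?powR_ge0// -powRrM mulVf ?powRr1 ?ltW//.
  by rewrite pnatr_eq0 -lt0n.
pose B i : set (measurableTypeR R) := `](tnth x i : R) - e, (tnth x i : R) + e[%classic.
have mB i : measurable (B i) by exact: measurable_itv.
have -> : (2 ^+ n * r)%:E = lebesgueRn R n [set t | forall i, B i (tnth t i)].
  rewrite tuple_measure_box//.
  have -> : (\prod_(i < n) lebesgue_measure (B i) = \prod_(i < n) (2 * e)%:E)%E.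
    apply: eq_bigr => i _; rewrite /B lebesgue_measure_itv/= lte_fin.
    rewrite ifT; last by rewrite ltrBlDr -addrA ltrDl addr_gt0.
    by rewrite -EFinD; congr EFin; ring.
  by rewrite prodEFin prodr_const card_ord exprMn en.
apply: le_measure; rewrite ?inE.
- rewrite -[X in measurable X]setTI.
  apply: (measurable_fun_ltr _ (measurable_cst r)) => //.
  apply: measurable_funX.
  exact: (measurableT_comp (@measurable_edist n) (pair1_measurable x)).
- rewrite (_ : mkset _ = \bigcap_(i in [set: 'I_n])
      ((fun t : Rn R n => tnth t i) @^-1` B i)).
    apply: fin_bigcap_measurable => // i _.
    by rewrite -[X in measurable X]setTI; apply: measurable_tnth.
  by apply/seteqP; split => t /= Bt i; [move=> _|]; exact: Bt.
- move=> y /= xyr i; rewrite /B /= in_itv/= -ltr_distlC.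
  apply: le_lt_trans (coord_le_edist x y i) _.
  by rewrite -(@ltr_pXn2r _ n)// ?nnegrE ?edist_ge0 ?(ltW e0)// en.
Qed.

End euclidean.

(** * The inequality on Euclidean space, for signed functions *)

Theorem theorem5 (R : realType) (n m : nat) (p q p' : R) (s : 'I_m -> R)
    (n_ge1 : (1 <= n)%N) (m_ge1 : (1 <= m)%N)
    (p_gt1 : 1 < p) (p_lt_q : p < q)
    (p_dual : 1 / p + 1 / p' = 1)
    (s_bounds : forall k : 'I_m, 1 < s k < p')
    (scaling : 1 / q + m%:R / p' = \sum_(k < m) 1 / s k) :
  exists C : R, forall H : Rnm R n m -> R,
    H \in Lfun (lebesgueRnm R n m) p%:E ->
    ('N[lebesgueRn R n]_q%:E[multi_frac_int (fun k => (n%:R / s k)%R) H]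
      <= C%:E * 'N[lebesgueRnm R n m]_p%:E[EFin \o H])%E.
Proof.
have p_gt0 : 0 < p by exact: lt_trans p_gt1.
have q_gt0 : 0 < q by exact: lt_trans p_lt_q.
have p'_gt0 : 0 < p'.
  by case: m m_ge1 s s_bounds {scaling} => // m' _ s' /(_ ord0) /andP[? ?]; lra.
have pp' : p^-1 + p'^-1 = 1 by rewrite -p_dual !div1r.
have s_gt0 k : 0 < s k by case/andP: (s_bounds k) => ? _; lra.
have alp k : p'^-1 < (s k)^-1.
  by rewrite ltf_pV2 ?posrE//; case/andP: (s_bounds k).
have alq : \sum_(k < m) ((s k)^-1 - p'^-1) = q^-1.
  rewrite big_split/= sumr_const card_ord.
  under eq_bigr do rewrite -div1r.
  by rewrite -scaling div1r mulNrn -[p'^-1 *+ m]mulr_natl addrK.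
(* The n-th power makes the measure of balls linear in the radius and turns the exponents n / s_k
   into 1 / s_k. *)
pose rho (x y : Rn R n) := Defs.edist x y ^+ n.
have mrho : measurable_fun setT (fun z : Rn R n * Rn R n => rho z.1 z.2).
  by apply: measurable_funX; exact: measurable_edist.
have rho_ge0 x y : 0 <= rho x y by rewrite exprn_ge0// edist_ge0.
have rhoC x y : rho x y = rho y x by rewrite /rho edistC.
have ballE x r : 0 < r ->
    (lebesgueRn R n [set y | (rho x y < r)%R] <= (2 ^+ n * r)%:E)%E.
  exact: edist_ball_le.
have [C C0 HC] := multilinear_hls mrho rho_ge0 rhoC (exprn_gt0 n (ltr0Sn _ 1))
  ballE p_gt1 p'_gt0 pp' p_lt_q m_ge1 alp alq.
exists (C `^ q^-1) => H; rewrite inE => /andP[]; rewrite !inE/= => mH Hfin.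
have kE x y k : Defs.edist x y `^ (- (n%:R / s k)) = rho x y `^ (- (s k)^-1).
  by rewrite /rho -powR_mulrn ?edist_ge0// -powRrM mulrN.
have mK : measurable_fun setT (fun z : Rn R n * Rnm R n m =>
    \prod_k rho z.1 (tnth z.2 k) `^ (- (s k)^-1)).
  apply: measurable_prod => j _; apply: measurable_fun_powR.
  have mpair : measurable_fun setT (fun z : Rn R n * Rnm R n m => (z.1, tnth z.2 j)).
    apply: measurable_fun_pair; first exact: measurable_fst.
    exact: (measurableT_comp (measurable_tnth j) measurable_snd).
  exact: (measurableT_comp mrho mpair).
(* The same integral with |H| in place of [H]. It dominates |F| at every [x], including points
   without absolute convergence, where it is +oo. *)
pose G x := (\int[lebesgueRnm R n m]_y
  ((\prod_k rho x (tnth y k) `^ (- (s k)^-1))%:E * `|(H y)%:E|))%E.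
have mG : measurable_fun setT G.
  apply: (@measurable_fun_fubini_tonelli_F _ _ _ _ _ (lebesgueRnm R n m)
    (fun z => (\prod_k rho z.1 (tnth z.2 k) `^ (- (s k)^-1))%:E * `|(H z.2)%:E|)%E).
    apply: emeasurable_funM; first by apply/measurable_EFinP.
    apply: measurableT_comp => //; apply/measurable_EFinP.
    exact: (measurableT_comp mH measurable_snd).
  move=> z; rewrite mule_ge0// lee_fin prodr_ge0// => k _; exact: powR_ge0.
have FG x : (`|multi_frac_int (fun k => (n%:R / s k)%R) H x| <= G x)%E.
  rewrite /multi_frac_int /G.
  under eq_integral do under eq_bigr do rewrite kE.
  apply: (le_trans (le_abse_integral _ measurableT _)).
    apply/measurable_EFinP; apply: measurable_funM => //.
    exact: (measurableT_comp mK (pair1_measurable x)).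
  rewrite le_eqVlt; apply/orP; left; apply/eqP/eq_integral => y _.
  rewrite EFinM abseM gee0_abs// lee_fin prodr_ge0// => k _; exact: powR_ge0.
(* The integrand is signed, so Tonelli is applied to its positive and negative parts separately. *)
have mF : measurable_fun setT (multi_frac_int (fun k => (n%:R / s k)%R) H).
  pose f (z : Rn R n * Rnm R n m) :=
    ((\prod_k rho z.1 (tnth z.2 k) `^ (- (s k)^-1)) * H z.2)%:E.
  have mf : measurable_fun setT f.
    apply/measurable_EFinP; apply: measurable_funM => //.
    exact: (measurableT_comp mH measurable_snd).
  have -> : multi_frac_int (fun k => (n%:R / s k)%R) H =
      (fubini_F (lebesgueRnm R n m) f^\+ \- fubini_F (lebesgueRnm R n m) f^\-)%E.
    apply/funext => x; rewrite /multi_frac_int.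
    under eq_integral do under eq_bigr do rewrite kE.
    rewrite integralE /fubini_F; congr (_ - _)%E; apply: eq_integral => y _.
      by rewrite !funeposE.
    by rewrite !funenegE.
  apply: emeasurable_funB; apply: measurable_fun_fubini_tonelli_F => //.
  - exact: measurable_funepos.
  - exact: measurable_funeneg.
pose N := fine 'N[lebesgueRnm R n m]_p%:E[EFin \o H]%E.
have NE : ('N[lebesgueRnm R n m]_p%:E[EFin \o H] = N%:E)%E.
  rewrite fineK// ge0_fin_numE ?Lnorm_ge0//.
have N0 : 0 <= N by rewrite fine_ge0 ?Lnorm_ge0.
rewrite NE -EFinM.
(* [multilinear_hls] asks for a positive bound, but the norm [N] may be 0. It is enlarged to [A],
   chosen so that the final estimate grows by exactly [e]. *)
apply/lee_addgt0Pr => e e0.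
have Cq0 : 0 < C `^ q^-1 by exact: powR_gt0.
pose A := N + e / C `^ q^-1.
have A0 : 0 < A by rewrite ltr_wpDl// divr_gt0.
have -> : ((C `^ q^-1 * N)%:E + e%:E)%E = (C `^ q^-1 * A)%:E.
  by rewrite -EFinD /A mulrDr mulrCA mulfV ?mulr1// gt_eqF.
have HA : (\int[lebesgueRnm R n m]_t (`|(H t)%:E| `^ p) <= (A `^ p)%:E)%E.
  have := poweR_Lnorm (lebesgueRnm R n m) (EFin \o H) (lt0r_neq0 p_gt0).
  move=> <-; rewrite NE poweR_EFin lee_fin.
  apply: ge0_ler_powR; rewrite ?nnegrE//; [exact: ltW|exact: ltW|].
  by rewrite lerDl divr_ge0 ?powR_ge0// ltW.
have mabsH : measurable_fun setT (fun t : Rnm R n m => `|(H t)%:E|%E).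
  by apply: measurableT_comp => //; apply/measurable_EFinP.
have GA := HC _ _ mabsH (fun t => abse_ge0 _) A0 HA.
have -> : (C `^ q^-1 * A)%:E = ((C * A `^ q)%:E `^ q^-1)%E.
  rewrite poweR_EFin powRM ?powR_ge0 ?(ltW C0)//.
  by rewrite -powRrM mulfV ?gt_eqF// powRr1// ltW.
rewrite unlock; apply: le_poweR.
- by rewrite invr_ge0 ltW.
- by apply: integral_ge0 => x _; exact: poweR_ge0.
apply: le_trans GA; apply: ge0_le_integralT.
- by move=> x; exact: poweR_ge0.
- by apply: measurable_fun_poweR; exact: measurableT_comp.
- exact: measurable_fun_poweR.
- by move=> x; apply: le_poweR => //; exact: ltW.
Qed.
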